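(* Assume $\alpha=1$. Then $h_N\to\infty$, and $h_N/N^{\epsilon}\to0$ for every $\epsilon>0$, as $N\to\infty$. Moreover, for every $\beta>0$, $$\frac{1}{Nh_N}\ln Z_N\to\frac\beta2\quad\text{in probability as }N\to\infty.$$
   Context: Lévy spin glass model with $\alpha=1$. Let $X$ be a symmetric real random variable with $\mathbb P(|X|>x)=L(x)/x$ for all $x>0$, where $L:(0,\infty)\to(0,\infty)$ is slowly varying at $\infty$, i.e. $\lim_{x\to\infty}L(tx)/L(x)=1$ for every $t>0$. For $N\ge1$ set $a_N=\inf\{x>0: N\,\mathbb P(|X|>x)\le 1\}$ and $J=a_N^{-1}X$ ($a_N>0$ for all large $N$, and only large $N$ matter). Let $(J_{ij})_{1\le i<j\le N}$ be i.i.d. copies of $J$ and $Z_N=\sum_{\sigma\in\{-1,1\}^N}\exp\bigl(\beta\sum_{1\le i<j\le N}J_{ij}\sigma_i\sigma_j\bigr)$. Set $b_N=a_N^{-1}a_{\binom N2}$ and $$h_N=\int_0^{b_N}\tanh(y)\,N\,\mathbb P(|X|>y\,a_N)\,dy .$$ *)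

(* Defs.v *)
From HB Require Import structures.
From mathcomp Require Import all_boot all_order all_algebra.
From mathcomp Require Import all_classical all_reals all_analysis.
Import Order.TTheory GRing.Theory Num.Theory.
Import numFieldNormedType.Exports.

Set Implicit Arguments.
Unset Strict Implicit.
Unset Printing Implicit Defensive.

Local Open Scope classical_set_scope.
Local Open Scope ring_scope.

Section RandomVariables.
Context {R : realType}.

(* Laws are compared on measurable sets only: [distribution] is a function on
   all subsets of R, so a Leibniz equality between laws would say too much. *)
Definition same_law d1 (T1 : measurableType d1) (P1 : probability T1 R)
    d2 (T2 : measurableType d2) (P2 : probability T2 R)
    (X : T1 -> R) (Y : T2 -> R) : Prop :=
  forall A : set R, measurable A -> P1 (X @^-1` A) = P2 (Y @^-1` A).

Definition symmetric_rv d (T : measurableType d) (P : probability T R)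
    (X : T -> R) : Prop :=
  same_law P P X (fun w => - X w).

Definition mutually_independent d (T : measurableType d) (P : probability T R)
    (I : finType) (D : {set I}) (X : I -> T -> R) : Prop :=
  forall (S : {set I}) (A : I -> set R),
    S \subset D ->
    (forall i, i \in S -> measurable (A i)) ->
    (P (\bigcap_(i in [set` S]) (X i @^-1` A i)) =
       \prod_(i in S) P (X i @^-1` A i))%E.

Definition iid_copies d0 (T0 : measurableType d0) (P0 : probability T0 R)
    (X0 : T0 -> R) d (T : measurableType d) (P : probability T R)
    (I : finType) (D : {set I}) (X : I -> T -> R) : Prop :=
  (forall i, i \in D -> same_law P P0 (X i) X0) /\ mutually_independent P D X.

(* The n-th random variable may live on its own probability space, as the
   limit is a constant. *)
Definition cvg_in_probability (d : nat -> measure_display)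
    (T : forall n, measurableType (d n)) (P : forall n, probability (T n) R)
    (Y : forall n, T n -> R) (l : R) : Prop :=
  forall e : R, 0 < e ->
    P n [set w | e < `|Y n w - l|] @[n --> \oo] --> 0%E.

Definition slowly_varying (L : R -> R) : Prop :=
  forall t : R, 0 < t -> L (t * x) / L x @[x --> +oo] --> (1 : R).

Definition tanh (y : R) : R :=
  (expR y - expR (- y)) / (expR y + expR (- y)).

End RandomVariables.

Section LevyModel.
Context {R : realType}.

Section Scales.
Context d (T : measurableType d) (P : probability T R) (X : T -> R).

Definition tail (x : R) : R := fine (P [set w | x < `|X w|]).

Definition a_ (N : nat) : R :=
  inf [set x : R | 0 < x /\ N%:R * tail x <= 1].

Definition b_ (N : nat) : R := (a_ N)^-1 * a_ 'C(N, 2).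

Definition h_ (N : nat) : R :=
  \int[lebesgue_measure]_(y in `[0, b_ N]) (tanh y * (N%:R * tail (y * a_ N))).

End Scales.

Definition spin (s : bool) : R := if s then 1 else - 1.

Definition upper_pairs (N : nat) : {set 'I_N * 'I_N} :=
  [set p : 'I_N * 'I_N | (p.1 < p.2)%N]%SET.

Definition partition_function (N : nat) (beta : R) (J : 'I_N * 'I_N -> R) : R :=
  \sum_(s : {ffun 'I_N -> bool})
    expR (beta * \sum_(i < N) \sum_(j < N | (i < j)%N)
                   J (i, j) * spin (s i) * spin (s j)).

End LevyModel.

(* Main.v *)
Require Import Defs.
From HB Require Import structures.
From mathcomp Require Import all_boot all_order all_algebra.
From mathcomp Require Import all_classical all_reals all_analysis.
From mathcomp Require Import measurable_realfun.
From mathcomp Require Import ring lra zify.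
Import Order.TTheory GRing.Theory Num.Theory.
Import numFieldNormedType.Exports.

(** Let t x = P(|X| > x).  Slow variation of L makes t regularly varying:
    t (c x) / t x tends to 1/c, so each doubling of x costs a factor close
    to 1/2.  Write a for a_N, b for b_N, h for h_N and Y for X / a.  The
    definition of a gives N t(a) of order 1, and C(N,2) t(a b) is of order 1 as well: the
    largest couplings are of order b.

    By Tonelli, h = N E[ln cosh (min(|Y|, b))] ([h_eq_mean]), which is
    N E[capped b Y] up to a bounded error, where capped b Y is min(|Y|, b)
    on |Y| > 1 and 0 elsewhere ([mean_lncosh], [near_h_mean]).  Slicing |Y|
    along powers of 2, each of the about log b levels between 1 and b
    contributes a quantity of order 1, up to factors close to 1 per level.
    Hence h diverges, h is smaller than any power of N, and, comparing the m
    levels just below b with b itself, b is negligible against N h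
    ([h_pinfty], [h_negligible], [near_cutoff_le_Nh]).

    For the free energy, split each coupling into a small part (|J| <= 1) and
    a large part.  Since E[small(J)^2] = O(1/N) and small(J) is centred,
    exponential moments and a union bound over the 2^N configurations show
    that the small parts contribute O(N) to the energy, uniformly in the
    configuration ([mean_small_partition]).  As h diverges, this and the
    entropy N ln 2 are negligible against N h, and ln Z is beta times the
    maximal energy of the large parts.  That maximum is at most the sum of
    the |large(J)|.  It is nearly attained: choosing the spins one after the
    other, each aligned with the field of the earlier ones, gives the energy
    sum_j |sum_(i<j) large(J_ij) s_i| ([greedy_spins]), and in the column j
    the largest entry wins up to twice the sum of the other ones
    ([norm_sum_ge]).  The loss is bounded by the sum over pairs of entries of
    the same column of the smaller of the two; its mean is O(N), because two
    entries of a column rarely exceed a level y together: the probability is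
    of order (N y)^-2 ([mean_collisions]).

    So ln Z is beta times the sum U of the capped couplings, up to o(N h).
    The mean of U is C(N,2) E[capped b Y], which is N h / 2 + O(N) + O(h),
    and its variance is at most b E[U], which is o((N h)^2) because b is
    negligible against N h ([mean_sqr_dev]).  Capping at b costs little: with
    high probability only boundedly many couplings exceed b, and none exceeds
    a large multiple of b ([mean_exceedances]).  The five bad events are
    collected in [log_partition_concentration]. *)

Set Implicit Arguments.
Unset Strict Implicit.
Unset Printing Implicit Defensive.
Local Open Scope classical_set_scope.
Local Open Scope ring_scope.

(** * Means of bounded measurable functions *)

(** All the random variables whose mean is taken below are bounded, so that
    linearity and monotonicity of the integral come without integrability
    side conditions. *)
Definition bounded_measurable {R : realType} d (T : measurableType d) (f : T -> R) :=
  measurable_fun setT f /\ exists M, forall x, `|f x| <= M.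

Section BoundedMeasurable.
Context {R : realType} d (T : measurableType d).
Implicit Types f g : T -> R.
Local Notation bm := bounded_measurable.

Lemma bm_cst (c : R) : bm (fun _ : T => c).
Proof. by split; [exact: measurable_cst|exists `|c|]. Qed.

Lemma bmD f g : bm f -> bm g -> bm (fun x => f x + g x).
Proof.
move=> [mf [M fM]] [mg [K gK]]; split; first exact: measurable_funD.
by exists (M + K) => x; rewrite (le_trans (ler_normD _ _))// lerD.
Qed.

Lemma bmM f g : bm f -> bm g -> bm (fun x => f x * g x).
Proof.
move=> [mf [M fM]] [mg [K gK]]; split; first exact: measurable_funM.
by exists (M * K) => x; rewrite normrM ler_pM.
Qed.

Lemma bmN f : bm f -> bm (fun x => - f x).
Proof.
move=> bf; under eq_fun do rewrite -mulN1r.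
exact/bmM/bf/bm_cst.
Qed.

Lemma bmB f g : bm f -> bm g -> bm (fun x => f x - g x).
Proof. by move=> bf bg; apply: bmD bf _; exact: bmN. Qed.

Lemma bm_sum I (r : seq I) (p : pred I) (F : I -> T -> R) :
  (forall i, p i -> bm (F i)) -> bm (fun x => \sum_(i <- r | p i) F i x).
Proof.
move=> bF; elim: r => [|i r IH].
  by under eq_fun do rewrite big_nil; exact: bm_cst.
under eq_fun do rewrite big_cons.
by have [pi|//] := boolP (p i); apply: bmD => //; exact: bF.
Qed.

Lemma bm_prod I (r : seq I) (p : pred I) (F : I -> T -> R) :
  (forall i, p i -> bm (F i)) -> bm (fun x => \prod_(i <- r | p i) F i x).
Proof.
move=> bF; elim: r => [|i r IH].
  by under eq_fun do rewrite big_nil; exact: bm_cst.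
under eq_fun do rewrite big_cons.
by have [pi|//] := boolP (p i); apply: bmM => //; exact: bF.
Qed.

Lemma bm_indic (A : set T) : measurable A -> bm (\1_A : T -> R).
Proof.
move=> mA; split; first exact: measurable_indic.
by exists 1 => x; rewrite indicE ger0_norm// lern1 leq_b1.
Qed.

End BoundedMeasurable.

Lemma bm_comp {R : realType} d (T : measurableType d) (f : R -> R) (X : T -> R) :
  bounded_measurable f -> measurable_fun setT X -> bounded_measurable (f \o X).
Proof.
move=> [mf [M fM]] mX; split; first exact: measurableT_comp.
by exists M => x /=.
Qed.

Section Expectation.
Context {R : realType} d (T : measurableType d) (P : probability T R).
Implicit Types f g : T -> R.
Local Notation bm := bounded_measurable.

Definition mean f : R := \int[P]_w f w.

Lemma bm_integrable f : bm f -> P.-integrable setT (EFin \o f).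
Proof.
move=> [mf [M fM]]; apply: measurable_bounded_integrable => //.
  by apply: (le_lt_trans (probability_le1 P measurableT)); rewrite ltry.
rewrite /bounded_near; near=> K => x _ /=.
by rewrite (le_trans (fM x)).
Unshelve. all: by end_near. Qed.

Lemma eq_mean f g : f =1 g -> mean f = mean g.
Proof. by move=> /funext ->. Qed.

Lemma mean_cst c : mean (fun _ => c) = c.
Proof. by have := probability_setT P; rewrite /mean Rintegral_cst//= => ->; rewrite mulr1. Qed.

Lemma meanD f g : bm f -> bm g -> mean (fun w => f w + g w) = mean f + mean g.
Proof. by move=> bf bg; apply: RintegralD => //; exact: bm_integrable. Qed.

Lemma meanZ c f : bm f -> mean (fun w => c * f w) = c * mean f.
Proof. by move=> bf; apply: RintegralZl => //; exact: bm_integrable. Qed.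

Lemma meanB f g : bm f -> bm g -> mean (fun w => f w - g w) = mean f - mean g.
Proof. by move=> bf bg; apply: RintegralB => //; exact: bm_integrable. Qed.

Lemma mean_sum I (r : seq I) (p : pred I) (F : I -> T -> R) :
  (forall i, p i -> bm (F i)) ->
  mean (fun w => \sum_(i <- r | p i) F i w) = \sum_(i <- r | p i) mean (F i).
Proof.
move=> bF; elim: r => [|i r IH].
  under eq_mean do rewrite big_nil.
  by rewrite mean_cst big_nil.
under eq_mean do rewrite big_cons.
rewrite big_cons; have [pi|//] := boolP (p i).
rewrite meanD; [by rewrite IH|exact: bF|exact: bm_sum].
Qed.

Lemma le_mean f g : bm f -> bm g -> (forall w, f w <= g w) -> mean f <= mean g.
Proof. by move=> bf bg fg; apply: le_Rintegral => //; exact: bm_integrable. Qed.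

Lemma mean_ge0 f : (forall w, 0 <= f w) -> 0 <= mean f.
Proof. by move=> f0; exact: Rintegral_ge0. Qed.

Lemma mean_indic (A : set T) : measurable A -> mean \1_A = fine (P A).
Proof. by move=> mA; rewrite /mean /Rintegral integral_indic// setIT. Qed.

Lemma mean_bool (b : T -> bool) : measurable [set w | b w] ->
  mean (fun w => (b w)%:R) = fine (P [set w | b w]).
Proof.
move=> mb; rewrite -mean_indic//; apply: eq_mean => w.
by rewrite indicE; congr (nat_of_bool _)%:R; apply/idP/idP; rewrite inE.
Qed.

Lemma probEfine (A : set T) : measurable A -> P A = (fine (P A))%:E.
Proof. by move=> mA; rewrite fineK// fin_num_measure. Qed.

Lemma markov_mean f c : bm f -> (forall w, 0 <= f w) -> 0 < c ->
  (P [set w | (c < f w)%R] <= (mean f / c)%:E)%E.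
Proof.
move=> bf f0 c0.
have mA : measurable [set w | c < f w].
  by rewrite -[X in measurable X]setTI; apply: measurable_fun_ltr => //; exact: bf.1.
rewrite probEfine// lee_fin ler_pdivlMr// -mean_indic// mulrC -meanZ; last exact: bm_indic.
apply: le_mean => //; first by apply: bmM; [exact: bm_cst|exact: bm_indic].
move=> w; rewrite indicE; have [|] := boolP (w \in _); rewrite ?mulr1 ?mulr0//.
by rewrite inE /= => /ltW.
Qed.

End Expectation.

Lemma mean_same_law {R : realType} d1 (T1 : measurableType d1) (P1 : probability T1 R)
    d2 (T2 : measurableType d2) (P2 : probability T2 R)
    (X : T1 -> R) (Y : T2 -> R) (f : R -> R) :
  measurable_fun setT X -> measurable_fun setT Y -> same_law P1 P2 X Y ->
  bounded_measurable f -> mean P1 (f \o X) = mean P2 (f \o Y).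
Proof.
move=> mX mY XY bf; rewrite /mean /Rintegral; congr fine.
pose X' : {mfun T1 >-> R} := HB.pack X (isMeasurableFun.Build _ _ _ _ _ mX).
pose Y' : {mfun T2 >-> R} := HB.pack Y (isMeasurableFun.Build _ _ _ _ _ mY).
have bX : bounded_measurable (f \o X) by exact: bm_comp.
have bY : bounded_measurable (f \o Y) by exact: bm_comp.
have mEf : measurable_fun setT (EFin \o f) by apply/measurable_EFinP; exact: bf.1.
have := @integral_distribution _ _ _ _ _ P1 X' (EFin \o f) mEf (bm_integrable P1 bX).
have := @integral_distribution _ _ _ _ _ P2 Y' (EFin \o f) mEf (bm_integrable P2 bY).
rewrite /comp /= => <- <-.
by apply: eq_measure_integral => A mA _; exact: XY.
Qed.

(** * Products of functions of independent variables *)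

Section Independence.
Context {R : realType} d (T : measurableType d) (P : probability T R).
Local Notation bm := bounded_measurable.
Local Notation E := (mean P).

Lemma le_mean_norm (f g : T -> R) : bm f -> bm g ->
  (forall w, `|f w| <= g w) -> `|E f| <= E g.
Proof.
move=> bf bg fg; rewrite ler_norml; apply/andP; split.
  rewrite -mulN1r -meanZ//; apply: le_mean => //.
    by apply: bmM => //; exact: bm_cst.
  by move=> w; have := fg w; rewrite ler_norml => /andP[]; rewrite mulN1r.
by apply: le_mean => // w; have := fg w; rewrite ler_norml => /andP[].
Qed.

Lemma sum_ord_lt (n m : nat) : \sum_(k < n) (k < m)%N%:R = (minn n m)%:R :> R.
Proof.
elim: n => [|n IH]; first by rewrite big_ord0 min0n.
rewrite big_ord_recr/= IH -natrD; congr (_%:R).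
by case: (leqP m n) => h; lia.
Qed.

(** The sum counts the k with (k+1)/n <= y, that is the integer part of n y. *)
Lemma step_approx (n : nat) (y : R) : (0 < n)%N -> 0 <= y <= 1 ->
  `|y - n%:R^-1 * \sum_(k < n) (k.+1%:R / n%:R <= y)%R%:R| <= n%:R^-1.
Proof.
move=> n0 /andP[y0 y1].
have n0' : 0 < n%:R :> R by rewrite ltr0n.
have ny0 : 0 <= y * n%:R by rewrite mulr_ge0 ?ler0n.
have /andP[] := truncn_itv ny0; set m := Num.trunc _ => my ym.
have mn : (m <= n)%N.
  by rewrite -(ler_nat R) (le_trans my)// ler_piMl// ler0n.
have -> : \sum_(k < n) (k.+1%:R / n%:R <= y)%R%:R = m%:R :> R.
  transitivity (\sum_(k < n) (k < m)%N%:R : R); last first.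
    by rewrite sum_ord_lt (minn_idPr mn).
  apply: eq_bigr => k _; rewrite ler_pdivrMr//.
  congr (nat_of_bool _)%:R; apply/idP/idP.
    by move=> /le_lt_trans/(_ ym); rewrite ltr_nat ltnS.
  by rewrite -(ler_nat R) => /le_trans; apply.
have -> : y - n%:R^-1 * m%:R = (y * n%:R - m%:R) * n%:R^-1.
  by field; rewrite gt_eqF.
rewrite normrM [X in _ * X]ger0_norm ?invr_ge0 ?ler0n//.
rewrite ler_piMl ?invr_ge0 ?ler0n// ger0_norm ?subr_ge0//.
by rewrite -natr1 in ym; lra.
Qed.

Lemma measurable_superlevel (f : R -> R) (c : R) : measurable_fun setT f ->
  measurable [set x | c <= f x].
Proof.
move=> mf; rewrite -[X in measurable X]setTI.
by apply: measurable_fun_ler => //; exact: measurable_cst.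
Qed.

Let mean_factor01 (X : T -> R) (W : T -> R) (c : R) (f : R -> R) :
  measurable_fun setT X -> bm W ->
  (forall A : set R, measurable A ->
     E (fun w => \1_A (X w) * W w) = c * E (fun w => \1_A (X w))) ->
  measurable_fun setT f -> (forall x, 0 <= f x <= 1) ->
  E (fun w => f (X w) * W w) = c * E (f \o X).
Proof.
move=> mX bW HA mf f01.
have [_ [K WK]] := bW.
have K0 : 0 <= K by rewrite (le_trans _ (WK point)).
have bf : bm f.
  by split=> //; exists 1 => x; case/andP: (f01 x) => ? ?; rewrite ger0_norm.
have bfX : bm (f \o X) by exact: bm_comp.
apply/eqP; rewrite -subr_eq0 -normr_le0; apply/ler_addgt0Pr => e e0; rewrite add0r.
(* the error is at most (K + |c|) / n *)
pose n := (Num.truncn ((K + `|c|) / e)).+1.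
have n0 : (0 < n)%N by [].
have n0' : 0 < n%:R :> R by rewrite ltr0n.
pose A k := [set x : R | k.+1%:R / n%:R <= f x].
have mA k : measurable (A k) by exact: measurable_superlevel.
pose g x := n%:R^-1 * \sum_(k < n) \1_(A k) x : R.
have bAX k : bm (fun w => \1_(A k) (X w) : R).
  by apply: (@bm_comp _ _ _ (\1_(A k)) X) => //; exact: bm_indic.
have gE x : g x = n%:R^-1 * \sum_(k < n) (k.+1%:R / n%:R <= f x)%R%:R.
  congr (_ * _); apply: eq_bigr => k _; rewrite indicE.
  by congr (nat_of_bool _)%:R; apply/idP/idP; rewrite inE.
have bgX : bm (fun w => g (X w)).
  by apply: bmM; [exact: bm_cst|apply: bm_sum => k _; exact: bAX].
have gW : E (fun w => g (X w) * W w) = c * E (fun w => g (X w)).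
  rewrite /g.
  under eq_mean do rewrite -mulrA mulr_suml.
  rewrite meanZ; last by apply: bm_sum => k _; exact: bmM.
  rewrite mean_sum; last by move=> k _; exact: bmM.
  rewrite meanZ; last by apply: bm_sum => k _; exact: bAX.
  rewrite mean_sum; last by move=> k _; exact: bAX.
  by rewrite mulrCA; congr (_ * _); rewrite mulr_sumr; apply: eq_bigr => k _; exact: HA.
have fg x : `|f x - g x| <= n%:R^-1 by rewrite gE; exact: step_approx.
have -> : E (fun w => f (X w) * W w) - c * E (f \o X) =
    E (fun w => (f (X w) - g (X w)) * W w) - c * E (fun w => f (X w) - g (X w)).
  rewrite (@eq_mean _ _ _ P (fun w => (f (X w) - g (X w)) * W w)
    (fun w => f (X w) * W w - g (X w) * W w)); last by move=> w; exact: mulrBl.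
  rewrite !meanB//; [|exact: bmM|exact: bmM].
  by rewrite gW /comp; ring.
have b1 : bm (fun w => f (X w) - g (X w)) by exact: bmB.
apply: (le_trans (ler_normB _ _)).
have H1 : `|E (fun w => (f (X w) - g (X w)) * W w)| <= n%:R^-1 * K.
  rewrite -[leRHS](mean_cst P); apply: le_mean_norm; [exact: bmM|exact: bm_cst|].
  by move=> w; rewrite normrM ler_pM.
have H2 : `|E (fun w => f (X w) - g (X w))| <= n%:R^-1.
  rewrite -[leRHS](mean_cst P); apply: le_mean_norm => //; exact: bm_cst.
rewrite normrM.
apply: (@le_trans _ _ (n%:R^-1 * (K + `|c|))).
  by rewrite mulrDr lerD// mulrC ler_wpM2r.
rewrite mulrC ler_pdivrMr// mulrC -ler_pdivrMr// ltW//.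
by rewrite /n; exact: truncnS_gt.
Qed.

(** Independence is given on sets; it passes to functions by the uniform
    approximation [step_approx], whose error is controlled by the bound on W.
    Taking A to be everything shows that c is the mean of W, but keeping c
    abstract is what lets the induction in [mean_prod_independent] run. *)
Lemma mean_factor (X : T -> R) (W : T -> R) (c : R) (f : R -> R) :
  measurable_fun setT X -> bm W ->
  (forall A : set R, measurable A ->
     E (fun w => \1_A (X w) * W w) = c * E (fun w => \1_A (X w))) ->
  bm f -> E (fun w => f (X w) * W w) = c * E (f \o X).
Proof.
move=> mX bW HA bf; have [mf [M0 fM0]] := bf.
pose M := Num.max M0 1.
have M1 : 0 < M by rewrite lt_max ltr01 orbT.
have fM x : `|f x| <= M by rewrite le_max fM0.
(* an affine change of f takes its values into the unit interval *)
pose g x := (2 * M)^-1 * (f x + M).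
have bg : bm g by apply: bmM; [exact: bm_cst|apply: bmD => //; exact: bm_cst].
have g01 x : 0 <= g x <= 1.
  have := fM x; rewrite ler_norml => /andP[? ?].
  rewrite /g mulrC; apply/andP; split; first by rewrite divr_ge0; lra.
  by rewrite ler_pdivrMr; lra.
have fE x : f x = 2 * M * g x - M by rewrite /g mulrA mulfV ?gt_eqF; lra.
have bgX : bm (fun w => g (X w)) by apply: (@bm_comp _ _ _ g X).
have H := mean_factor01 mX bW HA bg.1 g01.
have HT := HA setT measurableT.
have cW : E W = c.
  have e1 w : \1_[set: R] (X w) = 1 :> R by rewrite indicE in_setT.
  move: HT; under eq_mean do rewrite e1 mul1r.
  by move=> ->; under eq_mean do rewrite e1; rewrite mean_cst mulr1.
have b2 : bm (fun w => 2 * M * (g (X w) * W w)).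
  by apply: bmM; [exact: bm_cst|exact: bmM].
transitivity (2 * M * E (fun w => g (X w) * W w) - M * E W).
  rewrite -meanZ; last exact: bmM.
  rewrite -meanZ// -meanB//; last by apply: bmM => //; exact: bm_cst.
  by apply: eq_mean => w; rewrite fE; ring.
have -> : E (f \o X) = 2 * M * E (fun w => g (X w)) - M.
  rewrite -meanZ// -{2}(mean_cst P M) -meanB//; last exact: bm_cst.
    by apply: eq_mean => w; rewrite /= fE.
  by apply: bmM => //; exact: bm_cst.
by rewrite H cW /comp; ring.
Qed.

(** The indicators are replaced by the functions f i one index at a time:
    r lists the indices already replaced, and the others carry an arbitrary
    measurable set, which is what [mean_factor] needs at the next index. *)
Lemma mean_prod_independent (I : finType) (D S : {set I}) (X : I -> T -> R)
    (f : I -> R -> R) :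
  (forall i, measurable_fun setT (X i)) ->
  mutually_independent P D X -> S \subset D -> (forall i, bm (f i)) ->
  E (fun w => \prod_(i in S) f i (X i w)) = \prod_(i in S) E (f i \o X i).
Proof.
move=> mX indX SD bf.
have bfX i : bm (f i \o X i) by exact: bm_comp.
have bAX A i : measurable A -> bm (fun w => \1_A (X i w) : R).
  by move=> mA; apply: (@bm_comp _ _ _ (\1_A) (X i)) => //; exact: bm_indic.
suff H (r : seq I) (A : I -> set R) : uniq r -> (forall i, measurable (A i)) ->
    let g i x := if i \in r then f i x else \1_(A i) x in
    E (fun w => \prod_(i in S) g i (X i w)) = \prod_(i in S) E (g i \o X i).
  have /= := H (enum S) (fun=> setT) (enum_uniq _) (fun=> measurableT).
  under eq_mean => w.
    under eq_bigr => i iS do rewrite mem_enum iS.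
    over.
  move=> ->; apply: eq_bigr => i iS.
  by apply: eq_mean => w /=; rewrite mem_enum iS.
elim: r A => [|j r IH] A.
  move=> _ mA /=.
  under [RHS]eq_bigr => i _.
    rewrite (_ : _ \o _ = \1_(X i @^-1` A i)); last first.
      by apply/funext => w /=; rewrite !indicE; congr (nat_of_bool _)%:R.
    rewrite mean_indic; last by rewrite -[X in measurable X]setTI; exact: mX.
    over.
  have mB : measurable (\bigcap_(i in [set` S]) (X i @^-1` A i)).
    apply: fin_bigcap_measurable; first exact: finite_finset.
    by move=> i _; rewrite -[X in measurable X]setTI; exact: mX.
  transitivity (E \1_(\bigcap_(i in [set` S]) (X i @^-1` A i))).
    apply: eq_mean => w; rewrite indicE.
    have [|] := boolP (w \in _).
      rewrite inE /= => H; rewrite big1// => i iS.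
      by rewrite indicE mem_set//; exact: H.
    move=> H; apply/eqP; apply/negPn/negP => H'.
    move/negP : H; apply; rewrite inE /= => i /= iS.
    move: H' => /prodf_neq0/(_ i iS); rewrite indicE pnatr_eq0 eqb0 negbK inE//.
  rewrite mean_indic; last exact: mB.
  rewrite indX//.
  rewrite -[RHS]/(fine (_%:E)); congr fine.
  rewrite (big_morph _ EFinM erefl); apply: eq_bigr => i _.
  by rewrite -probEfine// -[X in measurable X]setTI; exact: mX.
move=> /= /andP[jr ur] mA.
have [jS|jS] := boolP (j \in S); last first.
  have neq i : i \in S -> (i == j) = false.
    by move=> iS; apply/negbTE; apply: contraNneq jS => <-.
  have := IH A ur mA => /=.
  under eq_mean => w.
    under eq_bigr => i iS.
      rewrite (_ : (i \in r) = (i \in j :: r)); last by rewrite inE neq.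
      over.
    over.
  move=> ->; apply: eq_bigr => i iS; apply: eq_mean => w /=.
  by rewrite inE neq.
under eq_mean => w do rewrite (bigD1 j)//= inE eqxx/=.
rewrite [RHS](bigD1 j)//=.
have -> : E ((fun x => if j \in j :: r then f j x else \1_(A j) x) \o X j) =
    E (f j \o X j) by apply: eq_mean => w /=; rewrite inE eqxx.
rewrite mulrC; apply: mean_factor => //.
  by apply: bm_prod => i _; case: (i \in j :: r); [exact: bfX|exact: bAX].
move=> B mB.
pose A' i := if i == j then B else A i.
have mA' i : measurable (A' i) by rewrite /A'; case: ifP.
have := IH A' ur mA' => /=.
rewrite (bigD1 j)//= (negbTE jr) mulrC.
rewrite (eq_mean _ (g := fun w => \1_B (X j w) * \prod_(i in S | i != j)
   (if i \in j :: r then f i (X i w) else \1_(A i) (X i w)))); last first.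
  move=> w; rewrite (bigD1 j)//= (negbTE jr) {1}/A' eqxx.
  by congr (_ * _); apply: eq_bigr => i /andP[_ ij]; rewrite inE /A' (negbTE ij).
move=> ->; congr (_ * _).
  apply: eq_bigr => i /andP[_ ij]; apply: eq_mean => w /=.
  by rewrite inE /A' (negbTE ij).
by apply: eq_mean => w; rewrite /= /A' eqxx.
Qed.

End Independence.

(** * Energies of spin configurations *)

Section Spins.
Context {R : realType}.
Implicit Types (N : nat).

Definition energy N (x : 'I_N * 'I_N -> R) (s : {ffun 'I_N -> bool}) : R :=
  \sum_(i < N) \sum_(j < N | (i < j)%N) x (i, j) * spin (s i) * spin (s j).

Lemma normr_spin b : `|@spin R b| = 1.
Proof. by case: b; rewrite /spin ?normrN normr1. Qed.

Lemma exists_spin (y : R) : exists b, spin b * y = `|y|.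
Proof.
have [y0|y0] := leP 0 y.
  by exists true; rewrite /spin mul1r ger0_norm.
by exists false; rewrite /spin mulN1r ltr0_norm.
Qed.

Lemma energyD N (x y : 'I_N * 'I_N -> R) s :
  energy (fun p => x p + y p) s = energy x s + energy y s.
Proof.
rewrite /energy -big_split; apply: eq_bigr => i _ /=.
by rewrite -big_split; apply: eq_bigr => j _ /=; ring.
Qed.

Lemma energy_pairs N (x : 'I_N * 'I_N -> R) s :
  energy x s = \sum_(p in upper_pairs N) x p * spin (s p.1) * spin (s p.2).
Proof.
rewrite /energy pair_big_dep/=.
by apply: eq_big => [[i j]|[i j] _] //=; rewrite inE.
Qed.

Lemma energy_le N (x : 'I_N * 'I_N -> R) s :
  energy x s <= \sum_(p in upper_pairs N) `|x p|.
Proof.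
rewrite energy_pairs; apply: ler_sum => p _.
by rewrite (le_trans (ler_norm _))// !normrM !normr_spin !mulr1.
Qed.

(** Each spin is chosen to agree with the field that the spins of smaller
    index exert on it; that field does not depend on later choices. *)
Lemma greedy_spins N (x : 'I_N * 'I_N -> R) : exists s,
  energy x s = \sum_(j < N) `|\sum_(i < N | (i < j)%N) x (i, j) * spin (s i)|.
Proof.
suff H k : exists s : {ffun 'I_N -> bool}, forall j : 'I_N, (j < k)%N ->
    spin (s j) * (\sum_(i < N | (i < j)%N) x (i, j) * spin (s i)) =
    `|\sum_(i < N | (i < j)%N) x (i, j) * spin (s i)|.
  have [s Hs] := H N; exists s.
  rewrite /energy (exchange_big_dep predT)//=; apply: eq_bigr => j _.
  by rewrite -Hs// mulr_sumr; apply: eq_bigr => i _; ring.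
elim: k => [|k [s Hs]]; first by exists [ffun=> true].
have [kN|Nk] := ltnP k N; last first.
  by exists s => j _; apply: Hs; apply: leq_trans Nk.
pose k' := Ordinal kN.
have [b Hb] := exists_spin (\sum_(i < N | (i < k)%N) x (i, k') * spin (s i)).
exists [ffun j => if j == k' then b else s j] => j jk.
have fieldE : \sum_(i < N | (i < j)%N)
     x (i, j) * spin ([ffun j0 => if j0 == k' then b else s j0] i) =
    \sum_(i < N | (i < j)%N) x (i, j) * spin (s i).
  apply: eq_bigr => i ij; rewrite ffunE.
  case: eqVneq => // ik; move: ij jk; rewrite ik ltnS /= => /leq_trans H /H.
  by rewrite ltnn.
rewrite fieldE ffunE; case: eqVneq => [jk'|jk'].
  by rewrite jk'.
apply: Hs; move: jk; rewrite ltnS leq_eqVlt => /orP[/eqP h|//].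
by move: jk'; rewrite -val_eqE /= h eqxx.
Qed.

(** If only the largest term exceeds b, or none does, the sum is at least the
    largest term minus the others, and each of these appears twice in the
    double sum, paired with the largest one.  If two terms exceed b, then the
    double sum already outweighs the capped sum. *)
Lemma norm_sum_ge (I : finType) (p : pred I) (x : I -> R) (b : R) : 0 <= b ->
  let u i := Num.min `|x i| b in
  \sum_(i | p i) u i - \sum_(i | p i) \sum_(k | p k && (k != i)) Num.min (u i) (u k)
    <= `|\sum_(i | p i) x i|.
Proof.
move=> b0 /=; pose u i := Num.min `|x i| b.
change (\sum_(i | p i) u i - \sum_(i | p i) \sum_(k | p k && (k != i)) Num.min (u i) (u k)
    <= `|\sum_(i | p i) x i|).
have u0 i : 0 <= u i by rewrite le_min normr_ge0 b0.
have uu0 i k : 0 <= Num.min (u i) (u k) by rewrite le_min !u0.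
have [i0 pi0|p0] := pickP p; last by rewrite !big_pred0 ?subrr ?normr_ge0.
pose m := [arg max_(i > i0 | p i) `|x i|]%O.
have [pm xm] : p m /\ forall i, p i -> `|x i| <= `|x m|.
  by rewrite /m; case: arg_maxP => // i pi Hi; split.
have um i : p i -> u i <= u m.
  by move=> pi; rewrite /u le_min ge_min xm//= ge_min lexx orbT.
pose S := \sum_(i | p i && (i != m)) u i.
have S0 : 0 <= S by apply: sumr_ge0.
have e1 : \sum_(i | p i) u i = u m + S by rewrite (bigD1 m).
have e2 : 2 * S <= \sum_(i | p i) \sum_(k | p k && (k != i)) Num.min (u i) (u k).
  rewrite (bigD1 m)//= mulr_natl mulr2n lerD//.
    by apply: ler_sum => k /andP[pk _]; rewrite le_min lexx um.
  apply: ler_sum => i /andP[pi im].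
  rewrite (bigD1 m)/=; last by rewrite pm eq_sym.
  rewrite (min_idPl (um _ pi)) lerDl; apply: sumr_ge0 => k _; exact: uu0.
have [/existsP[k /andP[/andP[pk km] bk]]|] :=
    boolP [exists k, (p k && (k != m)) && (b < `|x k|)].
  apply: (@le_trans _ _ 0) => //.
  have -> // : \sum_(i | p i) u i -
     \sum_(i | p i) \sum_(k0 | p k0 && (k0 != i)) Num.min (u i) (u k0) <= 0.
  have : u m <= S.
    rewrite /S (bigD1 k)/= ?pk//.
    have -> : u k = b by apply/min_idPr/ltW.
    apply: ler_wpDr; first by apply: sumr_ge0.
    by rewrite ge_min lexx orbT.
  lra.
rewrite negb_exists => /forallP H.
have uE k : p k -> k != m -> u k = `|x k|.
  by move=> pk km; apply/min_idPl; move: (H k); rewrite pk km /= -leNgt.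
have SE : `|\sum_(i | p i && (i != m)) x i| <= S.
  rewrite (le_trans (ler_norm_sum _ _ _))//; apply: ler_sum => i /andP[pi im].
  by rewrite uE.
have umx : u m <= `|x m| by rewrite ge_min lexx.
have : `|x m| <= `|\sum_(i | p i) x i| + `|\sum_(i | p i && (i != m)) x i|.
  rewrite [X in `|X| + _](bigD1 m)//=.
  set Y := \sum_(i | p i && (i != m)) x i.
  by have := ler_normB (x m + Y) Y; rewrite addrK.
lra.
Qed.

Lemma partition_function_gt0 N (beta : R) (x : 'I_N * 'I_N -> R) :
  0 < partition_function beta x.
Proof.
rewrite /partition_function (bigD1 [ffun=> true])//=.
by rewrite ltr_wpDr ?expR_gt0// sumr_ge0// => s _; exact: expR_ge0.
Qed.

Lemma ln_partition_function_ge N (beta : R) (x : 'I_N * 'I_N -> R) s :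
  beta * energy x s <= ln (partition_function beta x).
Proof.
rewrite -ler_expR lnK ?posrE ?partition_function_gt0//.
rewrite /partition_function (bigD1 s)//=.
by rewrite lerDl sumr_ge0// => ? _; exact: expR_ge0.
Qed.

Lemma ln_partition_function_le N (beta : R) (x : 'I_N * 'I_N -> R) M : 0 <= beta ->
  (forall s, energy x s <= M) ->
  ln (partition_function beta x) <= N%:R * ln 2 + beta * M.
Proof.
move=> b0 HM; rewrite -ler_expR lnK ?posrE ?partition_function_gt0//.
apply: (@le_trans _ _ (\sum_(s : {ffun 'I_N -> bool}) expR (beta * M))).
  by apply: ler_sum => s _; rewrite ler_expR ler_wpM2l//; exact: HM.
rewrite sumr_const card_ffun card_bool card_ord expRD.
by rewrite expRM_natl lnK ?posrE// -natrX mulr_natl.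
Qed.

End Spins.

(** * Scales of a regularly varying tail *)

Section RegularlyVaryingTail.
Context {R : realType}.
Variable t : R -> R.
Hypothesis t_ni : forall x y : R, 0 < x -> x <= y -> t y <= t x.
Hypothesis t_gt0 : forall x : R, 0 < x -> 0 < t x.
Hypothesis t_rv : forall c : R, 0 < c -> t (c * x) / t x @[x --> +oo] --> c^-1.

(** The scale a_N, for an abstract tail t. *)
Definition scale (N : nat) : R := inf [set x | 0 < x /\ N%:R * t x <= 1].

Lemma tail_ratio_le (c r : R) : 0 < c -> c^-1 < r ->
  exists2 x0, 0 < x0 & forall x, x0 <= x -> t (c * x) <= r * t x.
Proof.
move=> c0 cr; have /cvgr_lt/(_ _ cr)[M [_ HM]] := t_rv c0.
exists (Num.max 1 (M + 1)); first by rewrite lt_max ltr01.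
move=> x; rewrite ge_max => /andP[x1 Mx].
have x0 : 0 < x by lra.
by rewrite -ler_pdivrMr ?t_gt0//; apply/ltW/HM; lra.
Qed.

Lemma tail_ratio_ge (c r : R) : 0 < c -> r < c^-1 ->
  exists2 x0, 0 < x0 & forall x, x0 <= x -> r * t x <= t (c * x).
Proof.
move=> c0 cr; have /cvgr_gt/(_ _ cr)[M [_ HM]] := t_rv c0.
exists (Num.max 1 (M + 1)); first by rewrite lt_max ltr01.
move=> x; rewrite ge_max => /andP[x1 Mx].
have x0 : 0 < x by lra.
by rewrite -ler_pdivlMr ?t_gt0//; apply/ltW/HM; lra.
Qed.

(** A discrete form of the Potter bounds: along powers of 2, a ratio r
    arbitrarily close to 1/2 can be imposed at each step beyond some x0. *)
Lemma tail_dyadic_le (r : R) : 2^-1 < r -> exists2 x0, 0 < x0 &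
  forall x k, x0 <= x -> t (2 ^+ k * x) <= r ^+ k * t x.
Proof.
move=> r2; have [x0 x00 H] := tail_ratio_le (ltr0n R 2) r2.
exists x0 => // x k x0x; elim: k => [|k IH]; first by rewrite !expr0 !mul1r.
rewrite !exprS -!mulrA (le_trans (H _ _))//; last by rewrite ler_wpM2l//; lra.
by rewrite (le_trans x0x)// ler_peMl ?exprn_ege1//; lra.
Qed.

Lemma tail_dyadic_ge : exists2 x0, 0 < x0 &
  forall x k, x0 <= x -> t x <= 3 ^+ k * t (2 ^+ k * x).
Proof.
have [|x0 x00 H] := @tail_ratio_ge 2 (3^-1) (ltr0n R 2); first by lra.
exists x0 => // x k x0x; elim: k => [|k IH]; first by rewrite !expr0 !mul1r.
rewrite (le_trans IH)// !exprSr -!mulrA ler_wpM2l ?exprn_ge0//.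
rewrite mulrCA -ler_pdivrMl// H//.
by rewrite (le_trans x0x)// ler_peMl ?exprn_ege1//; lra.
Qed.

Lemma tail_small (e : R) : 0 < e -> exists2 x, 0 < x & t x <= e.
Proof.
move=> e0; have [|x0 x00 H] := @tail_dyadic_le (2 / 3); first by lra.
have : (2 / 3 : R) ^+ k * t x0 @[k --> \oo] --> 0 * t x0.
  by apply: cvgMl; apply: cvg_expr; rewrite ger0_norm; lra.
rewrite mul0r => /cvgr_lt/(_ _ e0)[k _ Hk].
exists (2 ^+ k * x0); first by rewrite mulr_gt0// exprn_gt0.
by rewrite (le_trans (H _ _ _))// ltW// Hk /=.
Qed.

Lemma scale_set_neq0 N : [set x | 0 < x /\ N%:R * t x <= 1] !=set0.
Proof.
have [|x x0 tx] := @tail_small (N.+1%:R^-1); first by rewrite invr_gt0.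
exists x; split => //; rewrite (@le_trans _ _ (N%:R * N.+1%:R^-1))//.
  by rewrite ler_wpM2l.
by rewrite ler_pdivrMr// mul1r ler_nat.
Qed.

Lemma scale_ge (N : nat) x : 0 < x -> 1 < N%:R * t x -> x <= scale N.
Proof.
move=> x0 Nx; apply: lb_le_inf; first exact: scale_set_neq0.
move=> y /= [y0 Ny]; rewrite leNgt; apply/negP => yx.
have : N%:R * t x <= N%:R * t y by rewrite ler_wpM2l// t_ni// ltW.
lra.
Qed.

Lemma scale_le (N : nat) x : 0 < x -> N%:R * t x <= 1 -> scale N <= x.
Proof.
move=> x0 Nx; apply: ge_inf; last by split.
by exists 0 => y [/ltW].
Qed.

Lemma scale_above (N : nat) x : scale N < x -> N%:R * t x <= 1.
Proof.
move=> /(inf_lt (scale_set_neq0 N))[y [y0 Ny] yx].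
by rewrite (le_trans _ Ny)// ler_wpM2l// t_ni// ltW.
Qed.

Lemma scale_below (N : nat) x : 0 < x -> x < scale N -> 1 < N%:R * t x.
Proof.
move=> x0 xN; have [//|Nx] := ltP 1 (N%:R * t x).
by have := scale_le x0 Nx; rewrite leNgt xN.
Qed.

Lemma near_natM (e K : R) : 0 < e -> \forall N \near \oo, K < N%:R * e.
Proof.
move=> e0; near=> N; rewrite -ltr_pdivrMr//.
near: N; exact: nbhs_infty_gtr.
Unshelve. all: by end_near. Qed.

Lemma scale_pinfty (x : R) : \forall N \near \oo, x <= scale N.
Proof.
pose y := Num.max 1 x; have y0 : 0 < y by rewrite lt_max ltr01.
near=> N; apply: (@le_trans _ _ y); first by rewrite le_max lexx orbT.
apply: scale_ge => //; near: N; apply: near_natM; exact: t_gt0.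
Unshelve. all: by end_near. Qed.

(** No regularity of t at its scale is needed: N t is at most 1 at twice the
    scale and more than 1 at half of it, and doubling the argument divides t
    by at most 3. *)
Lemma scale_tail : \forall N \near \oo,
  3^-1 <= N%:R * t (scale N) <= 3.
Proof.
have [x0 x00 H] := tail_dyadic_ge.
near=> N.
have : 2 * x0 <= scale N by near: N; exact: scale_pinfty.
set a := scale N => ax.
have a0 : 0 < a by lra.
have Na2 : N%:R * t (2 * a) <= 1 by apply: scale_above; rewrite -/a; lra.
have Nah : 1 < N%:R * t (2^-1 * a) by apply: scale_below; rewrite -/a; lra.
have h1 : t a <= 3 * t (2 * a) by have := H a 1%N; rewrite !expr1; apply; lra.
have h2 : t (2^-1 * a) <= 3 * t a.
  by have := H (2^-1 * a) 1%N; rewrite !expr1 mulVKf//; apply; lra.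
have N0 : 0 <= N%:R :> R by [].
have := ler_wpM2l N0 h1; have := ler_wpM2l N0 h2; lra.
Unshelve. all: by end_near. Qed.

Lemma near_bin2 (Q : nat -> Prop) : (\forall N \near \oo, Q N) ->
  \forall N \near \oo, Q 'C(N, 2).
Proof.
move=> [n _ Hn]; exists n.+3 => // N /= nN; apply: Hn => /=.
rewrite bin2; have : (n * 2 <= N * N.-1)%N by apply: leq_mul; lia.
by move=> h; rewrite geq_half_double -muln2.
Qed.

(** The ratio b_N, for an abstract tail t. *)
Definition cutoff (N : nat) : R := (scale N)^-1 * scale 'C(N, 2).

Lemma scale_gt0 : \forall N \near \oo, 0 < scale N.
Proof.
near=> N; apply: (@lt_le_trans _ _ 1) => //; near: N; exact: scale_pinfty.
Unshelve. all: by end_near. Qed.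

(** The product of the scale and the cutoff is the scale of the C(N,2)
    couplings. *)
Lemma cutoff_tail : \forall N \near \oo,
  3^-1 <= 'C(N, 2)%:R * t (scale N * cutoff N) <= 3.
Proof.
near=> N.
have a0 : 0 < scale N by near: N; exact: scale_gt0.
rewrite /cutoff mulVKf ?gt_eqF//; near: N.
exact: (near_bin2 scale_tail).
Unshelve. all: by end_near. Qed.

Lemma bin2R (N : nat) : 'C(N, 2)%:R = N%:R * (N%:R - 1) / 2 :> R.
Proof.
elim: N => [|N IH]; first by rewrite !mul0r.
by rewrite binS bin1 natrD IH -natr1; field.
Qed.

Lemma cutoff_pinfty (K : R) : \forall N \near \oo, K <= cutoff N.
Proof.
have [x0 x00 H] := tail_dyadic_ge.
have [k Kk] : exists k, K <= 2 ^+ k.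
  exists (Num.truncn K).+1; apply/ltW; apply: (lt_le_trans (truncnS_gt K)).
  by rewrite -natrX ler_nat ltnW// ltn_expl.
near=> N.
have a0 : 0 < scale N by near: N; exact: scale_gt0.
have ax : x0 <= scale N by near: N; exact: scale_pinfty.
have /andP[h1 _] : 3^-1 <= N%:R * t (scale N) <= 3 by near: N; exact: scale_tail.
rewrite (le_trans Kk)// /cutoff mulrC ler_pdivlMr//; apply: scale_ge.
  by rewrite mulr_gt0// exprn_gt0.
have h2 := H (scale N) k ax.
have p3 : 0 < 3 ^+ k :> R by rewrite exprn_gt0.
have NN : 1 + 2 * 3 * 3 ^+ k < N%:R :> R by near: N; exact: nbhs_infty_gtr.
rewrite bin2R; set T := t (2 ^+ k * _) in h2 *.
have T0 : 0 < T by rewrite t_gt0// mulr_gt0// exprn_gt0.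
have N0 : 0 < N%:R :> R by lra.
have h3 : 3^-1 <= N%:R * (3 ^+ k * T).
  by apply: (le_trans h1); rewrite ler_wpM2l// ltW.
have h4 : N%:R * T * (2 * 3 * 3 ^+ k) < N%:R * T * (N%:R - 1).
  by rewrite ltr_pM2l ?mulr_gt0//; lra.
have -> : N%:R * (N%:R - 1) / 2 * T = (N%:R * T * (N%:R - 1)) / 2 by field.
have e : N%:R * T * (2 * 3 * 3 ^+ k) = 6 * (N%:R * (3 ^+ k * T)) by ring.
lra.
Unshelve. all: by end_near. Qed.

Lemma exists_pow_between (c y : R) : 1 < c -> 1 <= y ->
  exists k : nat, y <= c ^+ k <= c * y.
Proof.
move=> c1 y1.
have ex : exists k, y <= c ^+ k.
  have : `|c^-1| < 1 by rewrite ger0_norm ?invr_ge0 ?invf_lt1; lra.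
  move=> /cvg_expr/cvgr_lt/(_ y^-1)[|k _ Hk]; first by rewrite invr_gt0; lra.
  exists k; have := Hk k (leqnn k); rewrite /= exprVn => /ltW.
  by rewrite lef_pV2 ?posrE ?exprn_gt0//; lra.
have [k ky kmin] := ex_minnP ex; exists k; rewrite ky/=.
case: k ky kmin => [|k] ky kmin; first by rewrite expr0; nra.
rewrite exprS ler_wpM2l//; first lra.
rewrite leNgt; apply/negP => /ltW/kmin; by rewrite ltnn.
Qed.

(** With 2^m of the order of the square root of N, the points 2^-k a_N with
    k <= m stay in the range where the dyadic bounds hold, because a_N grows
    faster than the square root of N: t loses at most a factor 3 per doubling
    and 3^m is negligible against 4^m. *)
Lemma scale_half_order (x0 : R) : 0 < x0 ->
  \forall N \near \oo, exists m : nat, N%:R <= 4 ^+ m :> R /\ 2 ^+ m * x0 <= scale N.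
Proof.
move=> x00'.
have [x1 x10 H] := tail_dyadic_ge.
pose z := Num.max x0 x1; have z0 : 0 < z by rewrite lt_max x00'.
have tz := t_gt0 z0.
have : (3 / 4 : R) ^+ k / t z @[k --> \oo] --> 0 / t z.
  by apply: cvgMl; apply: cvg_expr; rewrite ger0_norm; lra.
rewrite mul0r => /cvgr_lt/(_ 4^-1)[|k0 _ Hk0]; first lra.
near=> N.
have N1 : 1 <= N%:R :> R by near: N; exact: nbhs_infty_ger.
have [m /andP[m1 m2]] := @exists_pow_between 4 N%:R ltac:(lra) N1.
exists m; split => //.
apply: (@le_trans _ _ (2 ^+ m * z)).
  by rewrite ler_wpM2l ?exprn_ge0// le_max lexx.
apply: scale_ge; first by rewrite mulr_gt0// exprn_gt0.
have hz := H z m ltac:(by rewrite le_max lexx orbT).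
have mk : (k0 <= m)%N.
  rewrite leqNgt; apply/negP => mk.
  have : 4 ^+ m <= 4 ^+ k0 :> R by rewrite ler_weXn2l//; [lra|exact: ltnW].
  have : 4 ^+ k0 < N%:R :> R by near: N; exact: nbhs_infty_gtr.
  lra.
have := Hk0 _ mk; rewrite /= expr_div_n ltr_pdivrMr//.
rewrite ltr_pdivrMr ?exprn_gt0// => h.
have p3 : 0 < 3 ^+ m :> R by rewrite exprn_gt0.
rewrite -(ltr_pM2l p3) mulr1.
apply: (@lt_le_trans _ _ (N%:R * t z)); last first.
  by rewrite mulrCA ler_wpM2l.
apply: (lt_le_trans h).
have := ler_wpM2r (ltW tz) m2; lra.
Unshelve. all: by end_near. Qed.

(** The number m of dyadic levels below the cutoff is logarithmic in N: past
    m doublings the tail has lost a factor (3/2)^m, which is enough once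
    (3/2)^m exceeds 3 N / 2. *)
Lemma cutoff_poly : \forall N \near \oo, exists m : nat,
  cutoff N <= 2 ^+ m /\ (3 / 2) ^+ m <= 9 / 4 * N%:R :> R.
Proof.
have [|x0 x00 H] := @tail_dyadic_le (2 / 3); first by lra.
near=> N.
have N1 : 1 <= N%:R :> R by near: N; exact: nbhs_infty_ger.
have a0 : 0 < scale N by near: N; exact: scale_gt0.
have ax : x0 <= scale N by near: N; exact: scale_pinfty.
have /andP[_ h1] : 3^-1 <= N%:R * t (scale N) <= 3 by near: N; exact: scale_tail.
have [m /andP[m1 m2]] := @exists_pow_between (3 / 2) (3 / 2 * N%:R) ltac:(lra) ltac:(lra).
exists m; split; last lra.
rewrite /cutoff mulrC ler_pdivrMr//; apply: scale_le.
  by rewrite mulr_gt0// exprn_gt0.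
have h2 := H (scale N) m ax.
set T := t (_ * _) in h2 *.
have r0 : 0 < (3 / 2) ^+ m :> R by rewrite exprn_gt0; lra.
have e1 : (2 / 3) ^+ m = ((3 / 2) ^+ m)^-1 :> R by rewrite -exprVn; congr (_ ^+ _); field.
have h3 : (3 / 2) ^+ m * T <= t (scale N).
  by rewrite e1 in h2; rewrite -ler_pdivlMl.
have T0 : 0 < T by rewrite t_gt0// mulr_gt0// exprn_gt0.
have h4 : 3 / 2 * N%:R * T <= t (scale N).
  by apply: le_trans h3; rewrite ler_pM2r.
have h5 : N%:R * (3 / 2 * N%:R * T) <= 3.
  by apply: le_trans h1; rewrite ler_wpM2l.
rewrite bin2R.
have h6 : 0 <= N%:R * T by rewrite mulr_ge0// ltW.
have e2 : N%:R * (N%:R - 1) / 2 * T = (N%:R * (3 / 2 * N%:R * T)) / 3 - N%:R * T / 2 by field.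
lra.
Unshelve. all: by end_near. Qed.

End RegularlyVaryingTail.

(** * Splitting a coupling at absolute value 1 *)

Section Truncation.
Context {R : realType}.
Implicit Types x y z b c : R.

Definition small x : R := x * (`|x| <= 1)%R%:R.
Definition large x : R := x * (1 < `|x|)%R%:R.
Definition capped b x : R := Num.min `|large x| b.
Definition lncosh y : R := ln ((expR y + expR (- y)) / 2).

Lemma small_large x : x = small x + large x.
Proof. by rewrite /small /large; case: leP => _; rewrite !mulr1 !mulr0 ?addr0 ?add0r. Qed.

Lemma small_le1 x : `|small x| <= 1.
Proof.
rewrite /small; have [h|h] := leP `|x| 1; first by rewrite mulr1.
by rewrite mulr0 normr0.
Qed.

Lemma smallN x : small (- x) = - small x.
Proof. by rewrite /small normrN mulNr. Qed.

Lemma capped_ge0 b x : 0 <= b -> 0 <= capped b x.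
Proof. by move=> b0; rewrite le_min normr_ge0. Qed.

Lemma capped_le b x : capped b x <= b.
Proof. by rewrite ge_min lexx orbT. Qed.

Lemma capped_small b x : 0 <= b -> `|x| <= 1 -> capped b x = 0.
Proof.
move=> b0 x1; rewrite /capped /large ltNge x1/= mulr0 normr0.
exact/min_idPl.
Qed.

Lemma capped_large b x : 1 < `|x| -> capped b x = Num.min `|x| b.
Proof. by rewrite /capped /large => ->; rewrite mulr1. Qed.

Lemma bm_small : bounded_measurable small.
Proof.
split; last by exists 1; exact: small_le1.
apply: measurable_funM => //.
apply: (measurableT_comp (f := fun b : bool => b%:R : R)) => //.
apply: measurable_fun_ler => //; exact: measurable_cst.
Qed.

Lemma bm_sqr_small : bounded_measurable (fun x => small x ^+ 2).
Proof. by under eq_fun do rewrite expr2; apply: bmM; exact: bm_small. Qed.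

Lemma bm_capped b : 0 <= b -> bounded_measurable (capped b).
Proof.
move=> b0; split; last first.
  by exists b => x; rewrite ger0_norm ?capped_le// capped_ge0.
apply: measurable_minr; last exact: measurable_cst.
apply: measurableT_comp => //; apply: measurable_funM => //.
apply: (measurableT_comp (f := fun b : bool => b%:R : R)) => //.
apply: measurable_fun_ltr => //; exact: measurable_cst.
Qed.

(** The last level below z alone contributes at least z. *)
Lemma dyadic_cover m z : z <= 2 ^+ m ->
  z * (1 < z)%R%:R <= \sum_(k < m) 2 ^+ k.+1 * (2 ^+ k < z)%R%:R.
Proof.
elim: m => [|m IH] zm; first by rewrite big_ord0 ltNge zm/= mulr0.
rewrite big_ord_recr/=; have [zm'|mz] := leP z (2 ^+ m).
  by rewrite mulr0 addr0; exact: IH.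
have z0 : 0 < z by apply: lt_trans mz; rewrite exprn_gt0.
rewrite mulr1 ler_wpDl//.
  by apply: sumr_ge0 => k _; rewrite mulr_ge0 ?exprn_ge0.
by apply: le_trans zm; case: (1 < z); rewrite ?mulr1 ?mulr0 ?lexx ?(ltW z0).
Qed.

Lemma capped_le_dyadic b m x : 1 < b -> b <= 2 ^+ m ->
  capped b x <= \sum_(k < m) 2 ^+ k.+1 * (2 ^+ k < `|x|)%R%:R.
Proof.
move=> b1 bm; have [x1|x1] := leP `|x| 1.
  rewrite capped_small//; last lra.
  by apply: sumr_ge0 => k _; rewrite mulr_ge0 ?exprn_ge0.
rewrite capped_large//.
have := @dyadic_cover m (Num.min `|x| b); rewrite ge_min bm orbT => /(_ isT).
rewrite lt_min x1 b1 mulr1 => /le_trans; apply; apply: ler_sum => k _.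
by rewrite ler_wpM2l ?exprn_ge0// ler_nat lt_min; do 2 case: (_ < _).
Qed.

Lemma min_capped_le_dyadic b m x y : 1 < b -> b <= 2 ^+ m ->
  Num.min (capped b x) (capped b y) <=
  \sum_(k < m) 2 ^+ k.+1 * ((2 ^+ k < `|x|)%R%:R * (2 ^+ k < `|y|)%R%:R).
Proof.
move=> b1 bm; have b0 : 0 <= b by lra.
have s0 : 0 <= \sum_(k < m) 2 ^+ k.+1 * ((2 ^+ k < `|x|)%R%:R * (2 ^+ k < `|y|)%R%:R) :> R.
  by apply: sumr_ge0 => k _; rewrite !mulr_ge0 ?exprn_ge0.
have [x1|x1] := leP `|x| 1.
  by rewrite capped_small// ge_min s0.
have [y1|y1] := leP `|y| 1.
  by rewrite (capped_small (x := y))// ge_min s0 orbT.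
rewrite !capped_large//.
have zm : Num.min (Num.min `|x| b) (Num.min `|y| b) <= 2 ^+ m.
  by rewrite !ge_min bm !orbT.
have := dyadic_cover zm; rewrite !lt_min x1 y1 b1 /= mulr1.
move=> /le_trans; apply; apply: ler_sum => k _.
rewrite ler_wpM2l ?exprn_ge0// !lt_min -natrM ler_nat.
by do 3 case: (_ < _).
Qed.

(** The weights double at each level and each threshold is twice its weight,
    so that the weights up to the last threshold exceeded by z add up to less
    than this threshold. *)
Lemma dyadic_pack c m z : 0 <= c -> 0 <= z ->
  \sum_(j < m) c * 2 ^+ j * (c * 2 ^+ j.+1 < z)%R%:R <= Num.min z (c * 2 ^+ m).
Proof.
move=> c0 z0; elim: m => [|m IH].
  by rewrite big_ord0 le_min z0 expr0 mulr1.
rewrite big_ord_recr/= le_min; move: IH; rewrite le_min => /andP[h1 h2].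
have h3 : 0 <= c * 2 ^+ m by rewrite mulr_ge0 ?exprn_ge0.
rewrite exprS; case: ltP => h; rewrite ?mulr1 ?mulr0; apply/andP; split; lra.
Qed.

Lemma capped_ge_dyadic b c m x : 1 <= c -> c * 2 ^+ m <= b ->
  \sum_(j < m) c * 2 ^+ j * (c * 2 ^+ j.+1 < `|x|)%R%:R <= capped b x.
Proof.
move=> c1 cb; have c0 : 0 <= c by lra.
have b0 : 0 <= b by rewrite (le_trans _ cb)// mulr_ge0 ?exprn_ge0.
have [x1|x1] := leP `|x| 1; last first.
  rewrite capped_large// (le_trans (dyadic_pack _ _ _))//.
  by rewrite le_min !ge_min lexx cb orbT.
rewrite capped_small// big1// => j _; case: ltP; rewrite ?mulr0// => h.
have : 1 <= 2 ^+ j.+1 :> R by rewrite exprn_ege1//; lra.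
nra.
Qed.

(** The remainder 4^-m stands for the values below 2^-m, where the tail is
    not controlled. *)
Lemma sqr_small_le_dyadic m x :
  small x ^+ 2 <= \sum_(k < m) 4^-1 ^+ k * (2^-1 ^+ k.+1 < `|x|)%R%:R + 4^-1 ^+ m.
Proof.
have s0 n : 0 <= \sum_(k < n) 4^-1 ^+ k * (2^-1 ^+ k.+1 < `|x|)%R%:R :> R.
  by apply: sumr_ge0 => k _; rewrite mulr_ge0 ?exprn_ge0.
elim: m => [|m IH].
  rewrite big_ord0 add0r expr0 -real_normK ?num_real// expr_le1//.
  exact: small_le1.
have [h|h] := leP `|x| (2^-1 ^+ m.+1).
  rewrite ler_wpDl//.
  have -> : 4^-1 ^+ m.+1 = (2^-1 ^+ m.+1) ^+ 2 :> R.
    by rewrite -exprM mulnC exprM; congr (_ ^+ _); field.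
  rewrite -real_normK ?num_real// lerXn2r ?nnegrE ?exprn_ge0//.
  by apply: le_trans h; rewrite /small; have [_|_] := leP `|x| 1; rewrite ?mulr1 ?mulr0 ?normr0.
rewrite big_ord_recr/= h mulr1 (le_trans IH)// -addrA lerD2l lerDl.
by rewrite exprn_ge0.
Qed.

(** From exp(-y/2) >= 1 - y/2 follows exp y <= (1 - y/2)^-2, which is a
    rational function of y. *)
Lemma expR_le_quadratic y : y <= 1 -> expR y <= 1 + y + 2 * y ^+ 2.
Proof.
move=> y1.
have e1 : 1 - y / 2 <= expR (- (y / 2)) by exact: expR_ge1Dx.
have e2 : (1 - y / 2) ^+ 2 <= (expR y)^-1.
  rewrite -expRN (_ : - y = 2%:R * (- (y / 2))); last by field.
  by rewrite expRM_natl lerXn2r ?nnegrE ?expR_ge0//; lra.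
have e3 : 0 < (1 - y / 2) ^+ 2 by rewrite exprn_gt0//; lra.
have e4 : expR y <= ((1 - y / 2) ^+ 2)^-1.
  by rewrite -[leLHS]invrK lef_pV2 ?posrE// invr_gt0 expR_gt0.
apply: (le_trans e4); rewrite -[leLHS]mul1r ler_pdivrMr//.
have -> : (1 + y + 2 * y ^+ 2) * (1 - y / 2) ^+ 2 =
  1 + y ^+ 2 * ((1 - y) * (5 / 2 - y)) / 2 by field.
rewrite lerDl divr_ge0// mulr_ge0 ?sqr_ge0// mulr_ge0; lra.
Qed.

Lemma cosh_ge1 y : 1 <= (expR y + expR (- y)) / 2.
Proof. by have := expR_ge1Dx y; have := expR_ge1Dx (- y); lra. Qed.

Lemma lncosh_ge0 y : 0 <= lncosh y.
Proof. by rewrite ln_ge0// cosh_ge1. Qed.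

Lemma lncosh_le y : 0 <= y -> lncosh y <= y.
Proof.
move=> y0; rewrite -{2}(expRK y) ler_ln ?posrE ?expR_gt0//.
  have : expR (- y) <= expR y by rewrite ler_expR; lra.
  lra.
by have := cosh_ge1 y; lra.
Qed.

Lemma lncosh_ge y : y - ln 2 <= lncosh y.
Proof.
rewrite -{1}(expRK y) -ln_div ?posrE ?expR_gt0// ler_ln ?posrE ?divr_gt0 ?expR_gt0//.
  by rewrite ler_pM2r ?invr_gt0// lerDl expR_ge0.
by have := cosh_ge1 y; lra.
Qed.

Lemma lncosh_le_sqr y : 0 <= y <= 1 -> lncosh y <= 2 * y ^+ 2.
Proof.
move=> /andP[y0 y1]; rewrite -[leRHS]expRK ler_ln ?posrE ?expR_gt0//; last first.
  by have := cosh_ge1 y; lra.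
have h1 := expR_le_quadratic y1.
have h2 : expR (- y) <= 1 + - y + 2 * (- y) ^+ 2 by apply: expR_le_quadratic; lra.
have h3 := expR_ge1Dx (2 * y ^+ 2).
rewrite sqrrN in h2; lra.
Qed.

(** For large arguments ln cosh differs from the absolute value by at most
    ln 2; for small ones it is quadratic. *)
Lemma lncosh_capped b x : 1 <= b ->
  `|lncosh (Num.min `|x| b) - capped b x| <= 1 * (1 < `|x|)%R%:R + 2 * small x ^+ 2.
Proof.
move=> b1; have b0 : 0 <= b by lra.
have [x1|x1] := leP `|x| 1.
  rewrite capped_small// subr0 mulr0 add0r ger0_norm ?lncosh_ge0//.
  rewrite (min_idPl _); last lra.
  rewrite /small x1 mulr1 -(real_normK (num_real x)).
  by apply: lncosh_le_sqr; rewrite normr_ge0.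
rewrite capped_large// mulr1 ler_wpDr//; first by rewrite mulr_ge0 ?sqr_ge0.
set y := Num.min _ _.
have y0 : 0 <= y by rewrite le_min normr_ge0.
have h1 := lncosh_le y0; have h2 := lncosh_ge y.
have h3 : ln 2 <= 1 :> R.
  rewrite -[leRHS]expRK ler_ln ?posrE ?expR_gt0//.
  by have := expR_ge1Dx (1 : R); lra.
by rewrite ler_norml; apply/andP; split; lra.
Qed.

End Truncation.

(** * The normalisation h_N as a mean *)

Section LayerCake.
Context {R : realType}.
Local Notation mu := (@lebesgue_measure R).

Lemma is_derive_lncosh (y : R) : is_derive y 1 lncosh (tanh y).
Proof.
have e1 : is_derive y 1 (fun z : R => expR (- z)) (- expR (- y)).
  have -> : - expR (- y) = expR (- y) * -1 by rewrite mulrN1.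
  exact: (@is_derive1_comp _ expR -%R).
have e2 : is_derive y 1 (fun z : R => (expR z + expR (- z)) / 2)
    ((expR y - expR (- y)) / 2).
  under eq_fun do rewrite mulrC.
  rewrite mulrC.
  exact: is_deriveZ.
have p : 0 < (expR y + expR (- y)) / 2 by have := cosh_ge1 y; lra.
have -> : tanh y = ((expR y + expR (- y)) / 2)^-1 * ((expR y - expR (- y)) / 2).
  by rewrite /tanh; field; rewrite gt_eqF//; lra.
have e3 := @is_derive1_ln _ _ p.
exact: (@is_derive1_comp _ (@ln R) (fun z => (expR z + expR (- z)) / 2)).
Qed.

Lemma tanh_ge0 (y : R) : 0 <= y -> 0 <= tanh y.
Proof.
move=> y0; rewrite /tanh; apply: divr_ge0; last by rewrite addr_ge0 ?expR_ge0.
by rewrite subr_ge0 ler_expR; lra.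
Qed.

Lemma continuous_tanh : continuous (@tanh R).
Proof.
move=> y; rewrite /tanh.
have c : {for y, continuous (fun z : R => expR (- z))}.
  by apply: (@continuous_comp _ _ _ -%R expR); [exact: opp_continuous|exact: continuous_expR].
apply: cvgM; first by apply: cvgB; [exact: continuous_expR|exact: c].
apply: cvgV; first by rewrite gt_eqF// addr_gt0 ?expR_gt0.
by apply: cvgD; [exact: continuous_expR|exact: c].
Qed.

Lemma measurable_tanh : measurable_fun setT (@tanh R).
Proof. by apply: continuous_measurable_fun; exact: continuous_tanh. Qed.

Lemma continuous_lncosh : continuous (@lncosh R).
Proof.
move=> y; apply: differentiable_continuous; apply/derivable1_diffP.
by have [] := is_derive_lncosh y.
Qed.

Lemma measurable_lncosh : measurable_fun setT (@lncosh R).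
Proof. by apply: continuous_measurable_fun; exact: continuous_lncosh. Qed.

Lemma integral_tanh (b : R) : 0 <= b ->
  (\int[mu]_(y in `[0%R, b]) (tanh y)%:E = (lncosh b)%:E)%E.
Proof.
have l0 : lncosh 0 = 0 :> R by rewrite /lncosh oppr0 expR0 divff// ln1.
rewrite le_eqVlt => /predU1P[<-|b0].
  by rewrite set_itv1 integral_set1 l0.
have cl := continuous_lncosh.
rewrite (@continuous_FTC2 _ tanh lncosh)// ?l0 ?sube0//.
- by apply: continuous_subspaceT; exact: continuous_tanh.
- split.
  + by move=> x _; have [] := is_derive_lncosh x.
  + exact/cvg_at_right_filter/cl.
  + exact/cvg_at_left_filter/cl.
- by move=> x _; rewrite derive1E; have [] := is_derive_lncosh x.
Qed.

Lemma integral_tanh_lt (b z : R) : 0 <= b -> 0 <= z ->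
  (\int[mu]_(y in `[0%R, b]) (tanh y * (y < z)%R%:R)%:E = (lncosh (Num.min z b))%:E)%E.
Proof.
move=> b0 z0; have [zb|bz] := leP z b; last first.
  rewrite -integral_tanh//; apply: eq_integral => y; rewrite inE/= in_itv/= => /andP[_ yb].
  by rewrite (le_lt_trans yb bz) mulr1.
rewrite -integral_tanh// -[RHS]integral_itv_bndo_bndc; last first.
  apply/measurable_EFinP; exact: (measurable_funTS measurable_tanh).
rewrite [LHS]integral_mkcond [RHS]integral_mkcond; apply: eq_integral => y _.
rewrite !patchE; have [yz|zy] := ltP y z.
  rewrite mulr1; congr (if _ then _ else _); apply/idP/idP; rewrite !inE/= !in_itv/=.
    by move=> /andP[-> _]; rewrite yz.
  by move=> /andP[-> _]; rewrite (le_trans (ltW yz) zb).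
rewrite mulr0 if_same; case: ifPn => //; rewrite inE/= in_itv/= ltNge zy andbF//.
Qed.

(** Tonelli: the tail is the mean of the indicator of y a < |X|, and ln cosh
    is the primitive of tanh that vanishes at 0. *)
Lemma integral_tanh_tail d (T : measurableType d) (P : probability T R) (X : T -> R)
    (a b : R) : measurable_fun setT X -> 0 < a -> 0 <= b ->
  (\int[mu]_(y in `[0%R, b]) (tanh y * tail P X (y * a))%:E =
   (mean P (fun w => lncosh (Num.min `|a^-1 * X w| b)))%:E)%E.
Proof.
move=> mX a0 b0.
pose f (p : R * T) : \bar R :=
  (tanh p.1 * (p.1 * a < `|X p.2|)%R%:R * (p.1 \in `[0, b]%R)%:R)%:E.
have mf : measurable_fun setT f.
  apply/measurable_EFinP; apply: measurable_funM; first apply: measurable_funM.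
  - by apply: (measurableT_comp measurable_tanh); exact: measurable_fst.
  - apply: (measurableT_comp (f := fun b : bool => b%:R : R)) => //.
    apply: measurable_fun_ltr.
      by apply: measurable_funM; [exact: measurable_fst|exact: measurable_cst].
    apply: measurableT_comp => //; apply: (measurableT_comp mX); exact: measurable_snd.
  - apply: (measurableT_comp (f := fun b : bool => b%:R : R)) => //.
    under eq_fun do rewrite in_itv/=.
    apply: measurable_and; apply: measurable_fun_ler => //; exact: measurable_fst.
have f0 p : (0 <= f p)%E.
  rewrite /f; case: (boolP (p.1 \in `[0, b]%R)) => [|_]; last by rewrite mulr0.
  rewrite in_itv/= => /andP[p0 _]; rewrite lee_fin; apply: mulr_ge0; last by [].
  by apply: mulr_ge0; [exact: tanh_ge0|exact: ler0n].
have fE y w : f (y, w) =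
    if y \in `[0, b]%R then (tanh y * (y * a < `|X w|)%R%:R)%:E else 0%E.
  by rewrite /f -[(y, w).1]/y -[(y, w).2]/w; case: (y \in _); rewrite ?mulr1 ?mulr0.
transitivity (\int[mu]_y \int[P]_w f (y, w))%E.
  rewrite [LHS]integral_mkcond; apply: eq_integral => y _; rewrite patchE.
  under [RHS]eq_integral do rewrite fE.
  have -> : (y \in `[0, b]%classic) = (y \in `[0, b]%R) by apply/idP/idP => [/set_mem//|h]; exact/mem_set.
  case: ifP => yb; last by rewrite integral0.
  have mA : measurable [set w | y * a < `|X w|].
    rewrite -[X in measurable X]setTI; apply: measurable_fun_ltr => //.
    by apply: measurableT_comp.
  have bI : bounded_measurable (fun w => (y * a < `|X w|)%R%:R : R).
    split; last by exists 1 => w; case: (_ < _); rewrite ?normr1 ?normr0.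
    apply: (measurableT_comp (f := fun b : bool => b%:R : R)) => //.
    by apply: measurable_fun_ltr => //; apply: measurableT_comp.
  rewrite /tail -mean_bool// -meanZ// /mean /Rintegral fineK.
    by apply: eq_integral.
  apply: integrable_fin_num => //; apply: bm_integrable.
  by apply: bmM => //; exact: bm_cst.
rewrite fubini_tonelli// /mean /Rintegral fineK; last first.
  apply: integrable_fin_num => //; apply: bm_integrable.
  split; last first.
    exists b => w; rewrite ger0_norm ?lncosh_ge0// (le_trans (lncosh_le _))//.
      by rewrite le_min normr_ge0.
    by rewrite ge_min lexx orbT.
  apply: (measurableT_comp measurable_lncosh).
  apply: measurable_minr; last exact: measurable_cst.
  by apply: measurableT_comp => //; apply: measurable_funM => //; exact: measurable_cst.
apply: eq_integral => w _; rewrite -integral_tanh_lt//.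
rewrite [RHS]integral_mkcond; apply: eq_integral => y _; rewrite patchE fE.
have -> : (y \in `[0, b]%classic) = (y \in `[0, b]%R) by apply/idP/idP => [/set_mem//|h]; exact/mem_set.
case: ifP => yb //; congr ((_ * (nat_of_bool _)%:R)%:E).
by rewrite normrM gtr0_norm ?invr_gt0// ltr_pdivlMl// mulrC.
Qed.

Lemma h_eq_mean d (T : measurableType d) (P : probability T R) (X : T -> R) N :
  measurable_fun setT X -> 0 < a_ P X N -> 0 <= b_ P X N ->
  h_ P X N = N%:R *
    mean P (fun w => lncosh (Num.min `|(a_ P X N)^-1 * X w| (b_ P X N))).
Proof.
move=> mX a0 b0; rewrite /h_ /Rintegral.
under eq_integral do rewrite mulrCA EFinM.
have mt : measurable_fun setT (tail P X).
  apply: (nonincreasing_measurable measurableT) => x y xy.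
  have m z : measurable [set w | z < `|X w|].
    rewrite -[X in measurable X]setTI; apply: measurable_fun_ltr => //.
    by apply: measurableT_comp.
  rewrite /tail fine_le ?fin_num_measure// le_measure ?inE// => w /=.
  exact: le_lt_trans.
rewrite ge0_integralZl//; first last.
- move=> y; rewrite /= in_itv/= => /andP[y0 _].
  by rewrite lee_fin mulr_ge0 ?tanh_ge0// /tail fine_ge0.
- apply/measurable_EFinP; apply: measurable_funTS; apply: measurable_funM.
    exact: measurable_tanh.
  apply: (measurableT_comp mt); apply: measurable_funM => //; exact: measurable_cst.
by rewrite integral_tanh_tail.
Qed.

End LayerCake.

(** * Truncated moments in terms of the tail *)

Section TruncatedMoments.
Context {R : realType} d (T : measurableType d) (P : probability T R).
Variable Y : T -> R.
Hypothesis mY : measurable_fun setT Y.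
Local Notation E := (mean P).

Lemma measurable_tail_event y : measurable [set w | y < `|Y w|].
Proof.
rewrite -[X in measurable X]setTI; apply: measurable_fun_ltr => //.
by apply: measurableT_comp.
Qed.

Lemma bm_exceed y : bounded_measurable (fun w => (y < `|Y w|)%R%:R : R).
Proof.
split; last by exists 1 => w; case: (_ < _); rewrite ?normr1 ?normr0.
apply: (measurableT_comp (f := fun b : bool => b%:R : R)) => //.
by apply: measurable_fun_ltr => //; apply: measurableT_comp.
Qed.

Lemma mean_exceed y : E (fun w => (y < `|Y w|)%R%:R) = tail P Y y.
Proof. by rewrite /tail -mean_bool//; exact: measurable_tail_event. Qed.

Lemma mean_sum_exceed m (c y : nat -> R) :
  E (fun w => \sum_(k < m) c k * (y k < `|Y w|)%R%:R) =
  \sum_(k < m) c k * tail P Y (y k).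
Proof.
rewrite mean_sum => [|k _]; last by apply: bmM; [exact: bm_cst|exact: bm_exceed].
by apply: eq_bigr => k _; rewrite meanZ ?mean_exceed//; exact: bm_exceed.
Qed.

Lemma bm_sum_exceed m (c y : nat -> R) :
  bounded_measurable (fun w => \sum_(k < m) c k * (y k < `|Y w|)%R%:R).
Proof.
by apply: bm_sum => k _; apply: bmM; [exact: bm_cst|exact: bm_exceed].
Qed.

Lemma bm_capped_comp b : 0 <= b -> bounded_measurable (capped b \o Y).
Proof. by move=> b0; apply: bm_comp => //; exact: bm_capped. Qed.

Lemma bm_sqr_small_comp : bounded_measurable (fun w => small (Y w) ^+ 2).
Proof. by apply: (@bm_comp _ _ _ (fun x => small x ^+ 2) Y) => //; exact: bm_sqr_small. Qed.

Lemma mean_capped_le b m : 1 < b -> b <= 2 ^+ m ->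
  E (capped b \o Y) <= \sum_(k < m) 2 ^+ k.+1 * tail P Y (2 ^+ k).
Proof.
move=> b1 bm; rewrite -(mean_sum_exceed m (fun k => 2 ^+ k.+1) (fun k => 2 ^+ k)).
have b0 : 0 <= b by lra.
apply: le_mean; [exact: bm_capped_comp|
  exact: (bm_sum_exceed m (fun k => 2 ^+ k.+1) (fun k => 2 ^+ k))|].
by move=> w; exact: capped_le_dyadic.
Qed.

Lemma mean_capped_ge b c m : 1 <= c -> c * 2 ^+ m <= b ->
  \sum_(j < m) c * 2 ^+ j * tail P Y (c * 2 ^+ j.+1) <= E (capped b \o Y).
Proof.
move=> c1 cb.
rewrite -(mean_sum_exceed m (fun j => c * 2 ^+ j) (fun j => c * 2 ^+ j.+1)).
have b0 : 0 <= b by rewrite (le_trans _ cb)// mulr_ge0 ?exprn_ge0//; lra.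
apply: le_mean; [
  exact: (bm_sum_exceed m (fun j => c * 2 ^+ j) (fun j => c * 2 ^+ j.+1))|
  exact: bm_capped_comp|].
by move=> w; exact: capped_ge_dyadic.
Qed.

Lemma mean_sqr_small_le m : E (fun w => small (Y w) ^+ 2) <=
  \sum_(k < m) 4^-1 ^+ k * tail P Y (2^-1 ^+ k.+1) + 4^-1 ^+ m.
Proof.
rewrite -(mean_sum_exceed m (fun k => 4^-1 ^+ k) (fun k => 2^-1 ^+ k.+1)).
have bs := bm_sum_exceed m (fun k => 4^-1 ^+ k) (fun k => 2^-1 ^+ k.+1).
rewrite -[X in _ + X](mean_cst P) -meanD//; last exact: bm_cst.
apply: le_mean; [exact: bm_sqr_small_comp|by apply: bmD => //; exact: bm_cst|].
by move=> w; exact: sqr_small_le_dyadic.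
Qed.

Lemma bm_lncosh b : 0 <= b -> bounded_measurable (fun w => lncosh (Num.min `|Y w| b)).
Proof.
move=> b0; split; last first.
  exists b => w; rewrite ger0_norm ?lncosh_ge0// (le_trans (lncosh_le _))//.
    by rewrite le_min normr_ge0.
  by rewrite ge_min lexx orbT.
apply: (measurableT_comp (@measurable_lncosh R)).
apply: measurable_minr; last exact: measurable_cst.
exact: measurableT_comp.
Qed.

(** Both terms on the right are O(1/N) for the scaled coupling, so that the
    curvature of ln cosh near 0 only matters for bounded terms of h_N. *)
Lemma mean_lncosh b : 1 <= b ->
  `|E (fun w => lncosh (Num.min `|Y w| b)) - E (capped b \o Y)| <=
  tail P Y 1 + 2 * E (fun w => small (Y w) ^+ 2).
Proof.
move=> b1; have b0 : 0 <= b by lra.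
have bc := bm_capped_comp b0; have bl := bm_lncosh b0; have bs := bm_sqr_small_comp.
rewrite -meanB// -mean_exceed -meanZ// -meanD//; last first.
- by apply: bmM => //; exact: bm_cst.
- exact: bm_exceed.
apply: le_mean_norm; [exact: bmB| |].
  by apply: bmD; [exact: bm_exceed|apply: bmM => //; exact: bm_cst].
by move=> w /=; have := lncosh_capped (Y w) b1; rewrite mul1r.
Qed.

End TruncatedMoments.

(** * Growth of h_N *)

Section Scaling.
Context {R : realType} d (T : measurableType d) (P : probability T R).
Variables (X : {RV P >-> R}) (L : R -> R).
Hypothesis L_gt0 : forall x : R, 0 < x -> 0 < L x.
Hypothesis L_slowly_varying : slowly_varying L.
Hypothesis X_tail : forall x : R, 0 < x -> P [set w | x < `|X w|] = (L x / x)%:E.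

Local Notation t := (tail P X).
Local Notation a := (a_ P X).
Local Notation b := (b_ P X).
Local Notation h := (h_ P X).
Let mX : measurable_fun setT X := measurable_funP X.

Definition scaled N w := (a N)^-1 * X w.

Lemma measurable_scaled N : measurable_fun setT (scaled N).
Proof. by apply: measurable_funM => //; exact: measurable_cst. Qed.

Lemma tail_nonincreasing x y : 0 < x -> x <= y -> t y <= t x.
Proof.
move=> _ xy; rewrite /tail fine_le ?fin_num_measure ?le_measure ?inE//;
  try exact: measurable_tail_event.
by move=> w /=; exact: le_lt_trans.
Qed.

Lemma tail_gt0 x : 0 < x -> 0 < t x.
Proof. by move=> x0; rewrite /tail X_tail//= divr_gt0// L_gt0. Qed.

Lemma tail_ratio_cvg c : 0 < c -> t (c * x) / t x @[x --> +oo] --> c^-1.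
Proof.
move=> c0.
have H : c^-1 * (L (c * x) / L x) @[x --> +oo] --> c^-1 * 1.
  by apply: cvgMr; exact: L_slowly_varying.
rewrite mulr1 in H; apply: cvg_trans H; apply: near_eq_cvg; near=> x.
have x0 : 0 < x by [].
rewrite /tail !X_tail ?mulr_gt0//=.
by field; rewrite !gt_eqF ?L_gt0.
Unshelve. all: by end_near. Qed.

Lemma tail_scaled N y : 0 < a N -> tail P (scaled N) y = t (y * a N).
Proof.
move=> a0; rewrite /tail; congr (fine (P _)); apply/seteqP; split => w /=;
  by rewrite /scaled normrM gtr0_norm ?invr_gt0// ltr_pdivlMl// mulrC.
Qed.

Lemma near_scale_gt0 : \forall N \near \oo, 0 < a N.
Proof. exact: (scale_gt0 tail_nonincreasing tail_gt0 tail_ratio_cvg). Qed.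

Lemma near_scale_ge x : \forall N \near \oo, x <= a N.
Proof. exact: (scale_pinfty tail_nonincreasing tail_gt0 tail_ratio_cvg). Qed.

Lemma near_scale_tail : \forall N \near \oo, 3^-1 <= N%:R * t (a N) <= 3.
Proof. exact: (scale_tail tail_nonincreasing tail_gt0 tail_ratio_cvg). Qed.

Lemma near_cutoff_ge x : \forall N \near \oo, x <= b N.
Proof. exact: (cutoff_pinfty tail_nonincreasing tail_gt0 tail_ratio_cvg). Qed.

Lemma near_cutoff_tail : \forall N \near \oo, 3^-1 <= 'C(N, 2)%:R * t (a N * b N) <= 3.
Proof. exact: (cutoff_tail tail_nonincreasing tail_gt0 tail_ratio_cvg). Qed.

Lemma sum_geometric_le (r : R) m : 0 <= r < 1 -> \sum_(k < m) r ^+ k <= (1 - r)^-1.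
Proof.
move=> /andP[r0 r1]; rewrite -[leRHS]mul1r ler_pdivlMr; last lra.
have -> : (\sum_(k < m) r ^+ k) * (1 - r) = 1 - r ^+ m.
  by have := subrX1 r m; rewrite mulrC; set S := \sum_(_ < _) _; lra.
by rewrite gerBl exprn_ge0.
Qed.

(** The bound is 12 * 3 + 1: the dyadic levels 2^-k a_N give a geometric sum
    of ratio 3/4, and the remainder 4^-m is at most 1/N. *)
Lemma near_sqr_small : \forall N \near \oo,
  N%:R * mean P (fun w => small (scaled N w) ^+ 2) <= 37.
Proof.
have [x0 x00 H] := tail_dyadic_ge tail_gt0 tail_ratio_cvg.
near=> N.
have a0 : 0 < a N by near: N; exact: near_scale_gt0.
have /andP[_ Nt] : 3^-1 <= N%:R * t (a N) <= 3 by near: N; exact: near_scale_tail.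
have [m [m1 m2]] : exists m : nat, N%:R <= 4 ^+ m :> R /\ 2 ^+ m * x0 <= a N.
  by near: N; exact: (scale_half_order tail_nonincreasing tail_gt0 tail_ratio_cvg x00).
have N0 : 0 <= N%:R :> R by [].
apply: (le_trans (ler_wpM2l N0 (mean_sqr_small_le P (measurable_scaled N) m))).
have p2 k : 0 < 2 ^+ k :> R by rewrite exprn_gt0.
have p4 k : 0 < 4 ^+ k :> R by rewrite exprn_gt0.
have e k : (k < m)%N -> 4^-1 ^+ k * tail P (scaled N) (2^-1 ^+ k.+1) <=
    3 * t (a N) * (3 / 4) ^+ k.
  move=> km; rewrite tail_scaled//.
  have xk : x0 <= 2^-1 ^+ k.+1 * a N.
    rewrite exprVn ler_pdivlMl// (le_trans _ m2)// ler_wpM2r//; first lra.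
    by rewrite ler_weXn2l//; lra.
  have := H _ k.+1 xk; rewrite mulrA -exprMn divff// expr1n mul1r => h1.
  rewrite expr_div_n exprVn mulrC ler_pdivrMr// (le_trans h1)//.
  by rewrite exprS; have -> : 3 * t (a N) * (3 ^+ k / 4 ^+ k) * 4 ^+ k = 3 * 3 ^+ k * t (a N) by field; rewrite gt_eqF.
have s1 : \sum_(k < m) 4^-1 ^+ k * tail P (scaled N) (2^-1 ^+ k.+1) <=
    12 * t (a N).
  apply: (@le_trans _ _ (\sum_(k < m) 3 * t (a N) * (3 / 4) ^+ k)).
    by apply: ler_sum => k _; exact: e.
  rewrite -mulr_sumr (_ : 12 = 3 * 4); last by ring.
  rewrite -mulrA mulrC [leRHS]mulrC.
  have := @sum_geometric_le (3 / 4) m ltac:(lra); rewrite (_ : (1 - 3 / 4)^-1 = 4); last by field.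
  have := tail_gt0 a0; nra.
have s2 : N%:R * 4^-1 ^+ m <= 1 :> R by rewrite exprVn ler_pdivrMr// mul1r.
have := ler_wpM2l N0 s1; lra.
Unshelve. all: by end_near. Qed.

Lemma near_all_lt (m : nat) (Q : nat -> nat -> Prop) :
  (forall j, \forall N \near \oo, Q j N) ->
  \forall N \near \oo, forall j, (j < m)%N -> Q j N.
Proof.
move=> H; elim: m => [|m IH]; first by near=> N.
near=> N => j; rewrite ltnS leq_eqVlt => /predU1P[->|]; first by near: N.
by move: j; near: N.
Unshelve. all: by end_near. Qed.

Lemma near_dyadic_tail (r : R) : 2^-1 < r ->
  \forall N \near \oo, forall k, N%:R * t (2 ^+ k * a N) <= 3 * r ^+ k.
Proof.
move=> r2; have [x0 x00 H] := tail_dyadic_le tail_gt0 tail_ratio_cvg r2.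
near=> N => k.
have ax : x0 <= a N by near: N; exact: near_scale_ge.
have /andP[_ Nt] : 3^-1 <= N%:R * t (a N) <= 3 by near: N; exact: near_scale_tail.
apply: (le_trans (ler_wpM2l (ler0n R N) (H _ k ax))).
by rewrite mulrCA mulrC ler_wpM2r// exprn_ge0//; lra.
Unshelve. all: by end_near. Qed.

Lemma near_overflow :
  \forall N \near \oo, forall k,
    'C(N, 2)%:R * t (2 ^+ k * b N * a N) <= 3 * (2 / 3) ^+ k.
Proof.
have [|x0 x00 H] := tail_dyadic_le tail_gt0 tail_ratio_cvg (_ : 2^-1 < 2 / 3); first lra.
near=> N => k.
have a1 : 1 <= a N by near: N; exact: near_scale_ge.
have ax : x0 <= a N by near: N; exact: near_scale_ge.
have b1 : 1 <= b N by near: N; exact: near_cutoff_ge.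
have xb : x0 <= b N * a N by nra.
have /andP[_ Nt] : 3^-1 <= 'C(N, 2)%:R * t (a N * b N) <= 3 by near: N; exact: near_cutoff_tail.
rewrite -mulrA; apply: (le_trans (ler_wpM2l (ler0n R _) (H _ k xb))).
by rewrite mulrCA mulrC [b N * _]mulrC ler_wpM2r// exprn_ge0//; lra.
Unshelve. all: by end_near. Qed.

(** Squaring the tail turns the borderline level sum into a geometric one, of
    ratio 2 (2/3)^2 = 8/9. *)
Lemma near_pair_sum : \forall N \near \oo, forall m,
  N%:R ^+ 2 * \sum_(k < m) 2 ^+ k.+1 * (t (2 ^+ k * a N)) ^+ 2 <= 162.
Proof.
have r2 : 2^-1 < 2 / 3 :> R by lra.
near=> N => m.
have H : forall k, N%:R * t (2 ^+ k * a N) <= 3 * (2 / 3) ^+ k.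
  by near: N; exact: near_dyadic_tail.
have a0 : 0 < a N by near: N; exact: near_scale_gt0.
rewrite mulr_sumr; apply: (@le_trans _ _ (\sum_(k < m) 18 * (8 / 9) ^+ k)).
  apply: ler_sum => k _.
  have Nt0 : 0 <= N%:R * t (2 ^+ k * a N).
    by rewrite mulr_ge0// ltW// tail_gt0// mulr_gt0// exprn_gt0.
  have h2 : (N%:R * t (2 ^+ k * a N)) ^+ 2 <= (3 * (2 / 3) ^+ k) ^+ 2.
    by rewrite lerXn2r ?nnegrE// mulr_ge0// exprn_ge0.
  have -> : 18 * (8 / 9) ^+ k = 2 ^+ k.+1 * (3 * (2 / 3) ^+ k) ^+ 2 :> R.
    have -> : (3 * (2 / 3) ^+ k) ^+ 2 = 9 * ((2 / 3) ^+ 2) ^+ k :> R.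
      by rewrite [LHS]exprMn -exprM mulnC exprM; ring.
    have -> : (2 / 3) ^+ 2 = 4 / 9 :> R by field.
    have -> : 8 / 9 = 2 * (4 / 9) :> R by field.
    by rewrite [X in _ * X = _]exprMn exprS; ring.
  by rewrite mulrCA -exprMn ler_wpM2l ?exprn_ge0.
rewrite -mulr_sumr; have := @sum_geometric_le (8 / 9) m ltac:(lra).
by rewrite (_ : (1 - 8 / 9)^-1 = 9); [lra|field].
Unshelve. all: by end_near. Qed.

Definition capped_mean N := mean P (capped (b N) \o scaled N).

(** The constant is 3 + 2 * 37, by [near_scale_tail] and [near_sqr_small]. *)
Lemma near_h_mean : \forall N \near \oo, `|h N - N%:R * capped_mean N| <= 77.
Proof.
near=> N.
have a0 : 0 < a N by near: N; exact: near_scale_gt0.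
have b1 : 1 <= b N by near: N; exact: near_cutoff_ge.
have /andP[_ Nt] : 3^-1 <= N%:R * t (a N) <= 3 by near: N; exact: near_scale_tail.
have Ns : N%:R * mean P (fun w => small (scaled N w) ^+ 2) <= 37.
  by near: N; exact: near_sqr_small.
rewrite h_eq_mean//; last lra.
rewrite -mulrBr normrM ger0_norm//.
have := mean_lncosh P (measurable_scaled N) b1.
rewrite tail_scaled// mul1r => /(ler_wpM2l (ler0n R N)) /le_trans; apply; lra.
Unshelve. all: by end_near. Qed.

(** Each of the first m levels above the scale contributes t(a)/4, which is
    about half of what regular variation predicts. *)
Lemma near_capped_mean_ge m : \forall N \near \oo, m%:R / 12 <= N%:R * capped_mean N.
Proof.
near=> N.
have a0 : 0 < a N by near: N; exact: near_scale_gt0.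
have bm : 1 * 2 ^+ m <= b N by near: N; exact: near_cutoff_ge.
have /andP[Nt _] : 3^-1 <= N%:R * t (a N) <= 3 by near: N; exact: near_scale_tail.
have H : forall j, (j < m)%N -> (2 ^+ j.+2)^-1 * t (a N) <= t (2 ^+ j.+1 * a N).
  near: N; apply: near_all_lt => j.
  have [| |x0 x00 H] := tail_ratio_ge tail_gt0 tail_ratio_cvg (_ : 0 < 2 ^+ j.+1)
     (_ : (2 ^+ j.+2)^-1 < (2 ^+ j.+1)^-1).
  - by rewrite exprn_gt0.
  - by rewrite ltf_pV2 ?posrE ?exprn_gt0// [ltRHS]exprS ltr_pMl ?exprn_gt0//; lra.
  by near=> N; apply: H; near: N; exact: near_scale_ge.
have := mean_capped_ge P (measurable_scaled N) (lexx 1) bm.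
rewrite -/(capped_mean N) => h1.
have h2 : m%:R * (t (a N) / 4) <= capped_mean N.
  apply: le_trans h1.
  have -> : m%:R * (t (a N) / 4) = \sum_(j < m) t (a N) / 4.
    by rewrite sumr_const card_ord mulr_natl.
  apply: ler_sum => j _; rewrite !mul1r tail_scaled//.
  have p : 0 < 2 ^+ j :> R by rewrite exprn_gt0.
  have := ler_wpM2l (ltW p) (H j (ltn_ord j)); apply: le_trans.
  by rewrite le_eqVlt !exprS; apply/orP; left; apply/eqP; field; rewrite gt_eqF.
have := ler_wpM2l (ler0n R N) h2.
have : 0 <= m%:R :> R by [].
have -> : N%:R * (m%:R * (t (a N) / 4)) = m%:R * (N%:R * t (a N)) / 4 by field.
nra.
Unshelve. all: by end_near. Qed.

Lemma near_h_ge (K : R) : \forall N \near \oo, K <= h N.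
Proof.
pose m := (Num.truncn (12 * (K + 77))).+1.
have mK : 12 * (K + 77) < m%:R by exact: truncnS_gt.
near=> N.
have h1 : m%:R / 12 <= N%:R * capped_mean N by near: N; exact: near_capped_mean_ge.
have : `|h N - N%:R * capped_mean N| <= 77 by near: N; exact: near_h_mean.
rewrite ler_norml => /andP[h2 _]; lra.
Unshelve. all: by end_near. Qed.

Lemma h_pinfty : h N @[N --> \oo] --> +oo.
Proof. by apply/cvgryPge => K; exact: near_h_ge. Qed.

(** Each of the m levels just below b contributes to E[capped b Y] at least
    b t(a b) / 4, and N^2 t(a b) is bounded below; m is arbitrary. *)
Lemma near_cutoff_le_Nh (K : R) : \forall N \near \oo, K * b N <= N%:R * h N.
Proof.
pose m := (Num.truncn (12 * K)).+1.
have mK : 12 * K < m%:R by exact: truncnS_gt.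
near=> N.
have a1 : 1 <= a N by near: N; exact: near_scale_ge.
have a0 : 0 < a N by lra.
have bm : 1 * 2 ^+ m <= b N by near: N; exact: near_cutoff_ge.
have p2 k : 0 < 2 ^+ k :> R by rewrite exprn_gt0.
have b0 : 0 < b N by have := p2 m; lra.
have /andP[Nt _] : 3^-1 <= 'C(N, 2)%:R * t (a N * b N) <= 3 by near: N; exact: near_cutoff_tail.
have Hh : 77 <= h N by near: N; exact: near_h_ge.
have : `|h N - N%:R * capped_mean N| <= 77 by near: N; exact: near_h_mean.
rewrite ler_norml => /andP[h3 _].
have H : forall j, (j < m)%N -> 2 ^+ j / 2 * t (a N * b N) <= t ((2 ^+ j)^-1 * (a N * b N)).
  near: N; apply: near_all_lt => j.
  have [| |x0 x00 H] := tail_ratio_ge tail_gt0 tail_ratio_cvg (_ : 0 < (2 ^+ j)^-1)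
     (_ : 2 ^+ j / 2 < (2 ^+ j)^-1^-1).
  - by rewrite invr_gt0 exprn_gt0.
  - by rewrite invrK; have : 0 < 2 ^+ j :> R; [rewrite exprn_gt0|lra].
  near=> N; apply: H.
  have a1 : 1 <= a N by near: N; exact: near_scale_ge.
  have ax : x0 <= a N by near: N; exact: near_scale_ge.
  have b1 : 1 <= b N by near: N; exact: near_cutoff_ge.
  nra.
pose c := b N / 2 ^+ m.
have c1 : 1 <= c by rewrite /c ler_pdivlMr//.
have cb : c * 2 ^+ m <= b N by rewrite /c mulfVK ?gt_eqF.
have := mean_capped_ge P (measurable_scaled N) c1 cb.
rewrite -/(capped_mean N) => h1.
have h2 : m%:R * (b N * t (a N * b N) / 4) <= capped_mean N.
  apply: le_trans h1.
  have -> : m%:R * (b N * t (a N * b N) / 4) = \sum_(j < m) b N * t (a N * b N) / 4.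
    by rewrite sumr_const card_ord mulr_natl.
  apply: ler_sum => j _; rewrite tail_scaled//.
  have jm : (m - j.+1 < m)%N by rewrite ltn_subrL.
  have e : 2 ^+ m = 2 ^+ (m - j.+1) * 2 ^+ j.+1 :> R by rewrite -exprD subnK.
  have -> : c * 2 ^+ j.+1 * a N = (2 ^+ (m - j.+1))^-1 * (a N * b N).
    by rewrite /c e; field; rewrite !gt_eqF.
  have := H _ jm; set tt := t _ => h4.
  have h5 : c * 2 ^+ j * (2 ^+ (m - j.+1) / 2 * tt) = b N * tt / 4.
    by rewrite /c e exprS; field; rewrite !gt_eqF.
  by rewrite -h5 ler_wpM2l// mulr_ge0 ?ltW//; lra.
have N0 : 0 <= N%:R :> R by [].
have h5 := ler_wpM2l N0 h2.
have h6 := ler_wpM2l N0 h5.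
have : 2 * 'C(N, 2)%:R <= N%:R ^+ 2 :> R.
  by rewrite bin2R; nra.
set Q := 'C(N, 2)%:R in Nt *; set tt := t _ in h2 h5 h6 Nt => hQ.
have tt0 : 0 < tt by apply: tail_gt0; nra.
have h7 : 2 / 3 <= N%:R ^+ 2 * tt by have := ler_wpM2r (ltW tt0) hQ; lra.
have h8 : m%:R * b N * (2 / 3) <= m%:R * b N * (N%:R ^+ 2 * tt).
  by rewrite ler_wpM2l// mulr_ge0// ltW.
have h9 : m%:R * b N <= 12 * (N%:R * h N).
  have h10 : N%:R * (N%:R * capped_mean N) <= N%:R * (2 * h N).
    by rewrite ler_wpM2l//; lra.
  have e : N%:R * (N%:R * (m%:R * (b N * tt / 4))) = m%:R * b N * (N%:R ^+ 2 * tt) / 4 by field.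
  rewrite e in h6; lra.
have : 12 * K * b N <= m%:R * b N by rewrite ler_wpM2r ?ltW.
lra.
Unshelve. all: by end_near. Qed.

Lemma near_powR_ge (s K : R) : 0 < s -> \forall N \near \oo, K <= N%:R `^ s.
Proof.
move=> s0; pose M := Num.max K 0.
near=> N; apply: (@le_trans _ _ M); first by rewrite le_max lexx.
have M0 : 0 <= M by rewrite le_max lexx orbT.
have -> : M = (M `^ s^-1) `^ s by rewrite -powRrM mulVf ?gt_eqF// powRr1.
apply: ge0_ler_powR; rewrite ?nnegrE ?powR_ge0//; first exact: ltW.
by apply: ltW; near: N; exact: nbhs_infty_gtr.
Unshelve. all: by end_near. Qed.

(** With q > 1 and t shrinking by q/2 at each doubling, h is of order q^m for
    a logarithmic number m of levels; q is chosen so that q^m is at most of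
    order N^(eps/2). *)
Lemma h_negligible eps : 0 < eps -> h N / (N%:R `^ eps) @[N --> \oo] --> (0 : R).
Proof.
move=> eps0; pose s := eps / 2; have s0 : 0 < s by rewrite /s; lra.
pose q : R := (3 / 2) `^ s.
have one : 1 `^ s = 1 :> R by rewrite powR1.
have q1 : 1 < q.
  rewrite -[ltLHS]one /q; apply: gt0_ltr_powR; rewrite ?nnegrE//; lra.
have qr : 2^-1 < q / 2 by lra.
pose K := 77 + 6 / (q - 1) * (9 / 4) `^ s.
have K0 : 0 < K.
  by rewrite /K ltr_wpDr// mulr_ge0 ?powR_ge0// divr_ge0//; lra.
apply/cvgr0Pnorm_le => e e0; near=> N.
have N1 : 1 <= N%:R :> R by near: N; exact: nbhs_infty_ger.
have a0 : 0 < a N by near: N; exact: near_scale_gt0.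
have b2 : 2 <= b N by near: N; exact: near_cutoff_ge.
have h0 : 0 <= h N by near: N; exact: near_h_ge.
have : `|h N - N%:R * capped_mean N| <= 77 by near: N; exact: near_h_mean.
rewrite ler_norml => /andP[_ h3].
have [m [bm m2]] : exists m : nat, b N <= 2 ^+ m /\ (3 / 2) ^+ m <= 9 / 4 * N%:R :> R.
  by near: N; exact: (cutoff_poly tail_nonincreasing tail_gt0 tail_ratio_cvg).
have Hr : forall k, N%:R * t (2 ^+ k * a N) <= 3 * (q / 2) ^+ k.
  by near: N; exact: near_dyadic_tail.
have qm : q ^+ m <= (9 / 4) `^ s * N%:R `^ s.
  have p94 : 0 <= 9 / 4 :> R by lra.
  have p32 : 0 <= 3 / 2 :> R by lra.
  rewrite -powRM// /q -powR_mulrn ?powR_ge0// -powRrM [s * _]mulrC powRrM powR_mulrn//.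
  by apply: ge0_ler_powR; rewrite ?nnegrE ?exprn_ge0 ?mulr_ge0 ?(ltW s0) ?(ltW eps0)//.
have b1 : 1 < b N by lra.
have := ler_wpM2l (ler0n R N) (mean_capped_le P (measurable_scaled N) b1 bm).
rewrite -/(capped_mean N) => h4.
have h5 : N%:R * capped_mean N <= 6 / (q - 1) * q ^+ m.
  apply: (le_trans h4); rewrite mulr_sumr.
  apply: (@le_trans _ _ (\sum_(k < m) 6 * q ^+ k)).
    apply: ler_sum => k _; rewrite tail_scaled// mulrCA.
    have -> : 6 * q ^+ k = 2 ^+ k.+1 * (3 * (q / 2) ^+ k).
      by rewrite expr_div_n exprS; field; rewrite gt_eqF// exprn_gt0.
    by rewrite ler_wpM2l ?exprn_ge0.
  rewrite -mulr_sumr -mulrA ler_wpM2l//.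
  rewrite mulrC ler_pdivlMr; last lra.
  by have := subrX1 q m; set S := \sum_(_ < _) _; lra.
have Ns1 : 1 <= N%:R `^ s.
  by rewrite -[leLHS]one; apply: ge0_ler_powR; rewrite ?nnegrE// ltW.
have hK : h N <= K * N%:R `^ s.
  have h6 : 6 / (q - 1) * q ^+ m <= 6 / (q - 1) * ((9 / 4) `^ s * N%:R `^ s).
    by apply: ler_wpM2l; [apply: divr_ge0; lra|exact: qm].
  rewrite /K; lra.
have e2 : N%:R `^ eps = N%:R `^ s * N%:R `^ s.
  rewrite -powRD; first by congr (_ `^ _); rewrite /s; field.
  by apply/implyP => _; rewrite gt_eqF//; lra.
have Ne : K / e <= N%:R `^ s by near: N; exact: near_powR_ge.
have Np : 0 < N%:R `^ s by exact: lt_le_trans Ns1.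
rewrite ger0_norm ?divr_ge0 ?powR_ge0// e2 ler_pdivrMr ?mulr_gt0//.
apply: (le_trans hK); rewrite mulrA ler_wpM2r ?(ltW Np)//.
by rewrite mulrC -ler_pdivrMr.
Unshelve. all: by end_near. Qed.

End Scaling.

(** * Sums over the couplings at fixed size *)

Section FixedSize.
Context {R : realType} d0 (T0 : measurableType d0) (P0 : probability T0 R).
Variable Y : T0 -> R.
Hypothesis mY : measurable_fun setT Y.
Hypothesis small_centered : mean P0 (small \o Y) = 0.
Context (N : nat) d (T : measurableType d) (P : probability T R).
Variable J : 'I_N * 'I_N -> T -> R.
Hypothesis mJ : forall p, measurable_fun setT (J p).
Hypothesis iidJ : iid_copies P0 Y P (upper_pairs N) J.
Local Notation D := (upper_pairs N).
Local Notation E := (mean P).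
Local Notation E0 := (mean P0).
Local Notation bm := bounded_measurable.

Lemma card_upper_pairs : #|D| = 'C(N, 2).
Proof.
rewrite -sum1_card.
have -> : (\sum_(p in D) 1 = \sum_(p : 'I_N * 'I_N | (p.1 < p.2)%N) 1)%N.
  by apply: eq_bigl => p; rewrite inE.
rewrite -(pair_big_dep predT (fun i j : 'I_N => (i < j)%N) (fun _ _ => 1%N))/=.
rewrite (exchange_big_dep predT)//= -bin2_sum big_mkord.
apply: eq_bigr => j _.
by rewrite -(big_ord_widen N (fun=> 1%N) (ltnW (ltn_ord j))) sum_nat_const card_ord muln1.
Qed.

Lemma mean_J (f : R -> R) p : bm f -> p \in D -> E (f \o J p) = E0 (f \o Y).
Proof. by move=> bf pD; apply: mean_same_law => //; exact: iidJ.1. Qed.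

(** Under independence, means over the array of couplings reduce to means over
    the reference variable Y. *)
Lemma mean_J_prod (S : {set 'I_N * 'I_N}) (f : 'I_N * 'I_N -> R -> R) :
  S \subset D -> (forall p, bm (f p)) ->
  E (fun w => \prod_(p in S) f p (J p w)) = \prod_(p in S) E0 (f p \o Y).
Proof.
move=> SD bf; rewrite (mean_prod_independent mJ iidJ.2 SD bf).
by apply: eq_bigr => p pS; apply: mean_J => //; exact: (fintype.subsetP SD).
Qed.

Lemma mean_J_pair (f g : R -> R) p q : bm f -> bm g -> p \in D -> q \in D -> p != q ->
  E (fun w => f (J p w) * g (J q w)) = E0 (f \o Y) * E0 (g \o Y).
Proof.
move=> bf bg pD qD pq.
have SD : [set p; q]%SET \subset D.
  by apply/fintype.subsetP => r; rewrite in_set2 => /orP[] /eqP ->.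
pose F r := if r == p then f else g.
have bF r : bm (F r) by rewrite /F; case: ifP.
have := mean_J_prod SD bF.
have prodE (G : 'I_N * 'I_N -> R) : \prod_(r in [set p; q]%SET) G r = G p * G q.
  rewrite (bigD1 p) ?set21//= (big_pred1 q)// => r /=.
  by rewrite in_set2; have [->|] := eqVneq r p; rewrite ?(negbTE pq)//= andbT.
have Fp : F p = f by rewrite /F eqxx.
have Fq : F q = g by rewrite /F eq_sym (negbTE pq).
by rewrite prodE Fp Fq => <-; apply: eq_mean => w; rewrite prodE Fp Fq.
Qed.

Local Notation s2 := (E0 (fun w => small (Y w) ^+ 2)).

Lemma bm_expR (f : R -> R) : bm f -> bm (fun x => expR (f x)).
Proof.
move=> [mf [M fM]]; split; first by apply: measurableT_comp.
exists (expR M) => x; rewrite ger0_norm ?expR_ge0// ler_expR.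
by rewrite (le_trans (ler_norm _)).
Qed.

Lemma bm_expR_small c : bm (fun x : R => expR (c * small x)).
Proof. by apply: bm_expR; apply: bmM; [exact: bm_cst|exact: bm_small]. Qed.

(** The linear term of the quadratic bound for exp vanishes by centring. *)
Lemma mean_expR_small (c : R) : `|c| = 1 ->
  E0 (fun w => expR (c * small (Y w))) <= expR (2 * s2).
Proof.
move=> c1; apply: (le_trans _ (expR_ge1Dx _)).
have b1 : bm (fun w => small (Y w)) by apply: (@bm_comp _ _ _ small Y) => //; exact: bm_small.
have b2 := bm_sqr_small_comp mY.
have bc : bm (fun w => c * small (Y w)) by apply: bmM => //; exact: bm_cst.
have b22 : bm (fun w => 2 * small (Y w) ^+ 2) by apply: bmM => //; exact: bm_cst.
have -> : 1 + 2 * s2 = E0 (fun w => 1 + c * small (Y w) + 2 * small (Y w) ^+ 2).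
  rewrite meanD//; last by apply: bmD => //; exact: bm_cst.
  rewrite meanD//; last exact: bm_cst.
  rewrite mean_cst meanZ// meanZ//.
  by rewrite [X in c * X]small_centered mulr0 addr0.
apply: le_mean.
- by apply: (@bm_comp _ _ _ (fun x => expR (c * small x)) Y) => //; exact: bm_expR_small.
- by apply: bmD => //; apply: bmD => //; exact: bm_cst.
move=> w; have cc : c ^+ 2 = 1 by rewrite -real_normK ?num_real// c1 expr1n.
have := @expR_le_quadratic R (c * small (Y w)); rewrite exprMn cc mul1r; apply.
by rewrite (le_trans (ler_norm _))// normrM c1 mul1r small_le1.
Qed.

Definition small_energy s w := energy (fun p => small (J p w)) s.

(** Bounding this sum bounds all the energies at once, from both sides. *)
Definition small_partition w : R :=
  \sum_(s : {ffun 'I_N -> bool}) (expR (small_energy s w) + expR (- small_energy s w)).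

Lemma expR_energy (e : R) s w : expR (e * small_energy s w) =
  \prod_(p in D) expR (e * spin (s p.1) * spin (s p.2) * small (J p w)).
Proof.
rewrite /small_energy energy_pairs mulr_sumr expR_sum.
by apply: eq_bigr => p _; congr expR; ring.
Qed.

Lemma bm_expR_energy (e : R) s : bm (fun w => expR (e * small_energy s w)).
Proof.
under eq_fun do rewrite expR_energy; apply: bm_prod => p _.
apply: (@bm_comp _ _ _ (fun x => expR (e * spin (s p.1) * spin (s p.2) * small x)) (J p)) => //.
exact: bm_expR_small.
Qed.

Lemma mean_expR_energy (e : R) s : `|e| = 1 ->
  E (fun w => expR (e * small_energy s w)) <= expR (2 * s2 * 'C(N, 2)%:R).
Proof.
move=> e1; under eq_mean do rewrite expR_energy.
rewrite (mean_J_prod (f := fun p x => expR (e * spin (s p.1) * spin (s p.2) * small x)))//;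
  last by move=> p; exact: bm_expR_small.
apply: (@le_trans _ _ (\prod_(p in D) expR (2 * s2))).
  apply: ler_prod => p _; rewrite mean_ge0/=; last by move=> w; exact: expR_ge0.
  by apply: mean_expR_small; rewrite !normrM !normr_spin e1 !mulr1.
by rewrite prodr_const card_upper_pairs expRM_natr.
Qed.

Lemma bm_small_partition : bm small_partition.
Proof.
apply: bm_sum => s _; apply: bmD.
  by have := bm_expR_energy 1 s; under eq_fun do rewrite mul1r.
by have := bm_expR_energy (-1) s; under eq_fun do rewrite mulN1r.
Qed.

Lemma small_partition_ge0 w : 0 <= small_partition w.
Proof. by apply: sumr_ge0 => s _; rewrite addr_ge0 ?expR_ge0. Qed.

Lemma mean_small_partition :
  E small_partition <= 2 ^+ N * (2 * expR (2 * s2 * 'C(N, 2)%:R)).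
Proof.
have b1 s : bm (fun w => expR (small_energy s w)).
  by have := bm_expR_energy 1 s; under eq_fun do rewrite mul1r.
have b2 s : bm (fun w => expR (- small_energy s w)).
  by have := bm_expR_energy (-1) s; under eq_fun do rewrite mulN1r.
rewrite mean_sum; last by move=> s _; exact: bmD.
apply: (@le_trans _ _ (\sum_(s : {ffun 'I_N -> bool}) 2 * expR (2 * s2 * 'C(N, 2)%:R))).
  apply: ler_sum => s _; rewrite meanD// mulr_natl mulr2n lerD//.
    have := @mean_expR_energy 1 s; rewrite normr1 => /(_ erefl).
    by under eq_mean do rewrite mul1r.
  have := @mean_expR_energy (-1) s; rewrite normrN1 => /(_ erefl).
  by under eq_mean do rewrite mulN1r.
by rewrite sumr_const card_ffun card_bool card_ord -[leLHS]mulr_natl natrX.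
Qed.

Lemma small_energy_le A w : small_partition w <= expR A ->
  forall s, `|small_energy s w| <= A.
Proof.
move=> H s; have H' : expR (small_energy s w) + expR (- small_energy s w) <= expR A.
  apply: le_trans H; rewrite /small_partition (bigD1 s)//= lerDl.
  by apply: sumr_ge0 => ? _; rewrite addr_ge0 ?expR_ge0.
have := expR_ge0 (small_energy s w); have := expR_ge0 (- small_energy s w) => h1 h2.
by rewrite ler_norml lerNl -ler_expR -[X in _ && X]ler_expR; apply/andP; split; lra.
Qed.

Section Capped.
Variable b : R.
Hypothesis b1 : 1 < b.
Let b0 : 0 <= b. Proof. exact: ltW (lt_trans ltr01 b1). Qed.
Local Notation mu := (E0 (capped b \o Y)).

Definition capped_sum w := \sum_(p in D) capped b (J p w).

Lemma bm_capped_dev : bm (fun x => capped b x - mu).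
Proof. by apply: bmB; [exact: bm_capped|exact: bm_cst]. Qed.

Lemma bm_cappedJ p : bm (fun w => capped b (J p w)).
Proof. by apply: (@bm_comp _ _ _ (capped b) (J p)) => //; exact: bm_capped. Qed.

Lemma capped_sum_dev w : capped_sum w - 'C(N, 2)%:R * mu =
  \sum_(p in D) (capped b (J p w) - mu).
Proof. by rewrite big_split/= sumr_const card_upper_pairs mulNrn mulr_natl. Qed.

Lemma bm_sqr_dev : bm (fun w => (capped_sum w - 'C(N, 2)%:R * mu) ^+ 2).
Proof.
under eq_fun do rewrite expr2; apply: bmM; (apply: bmB; last exact: bm_cst);
  apply: bm_sum => p _; exact: bm_cappedJ.
Qed.

(** The cross terms vanish by independence; on the diagonal, the second moment
    of a variable with values in [0, b] is at most b times its mean. *)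
Lemma mean_sqr_dev : E (fun w => (capped_sum w - 'C(N, 2)%:R * mu) ^+ 2)
  <= 'C(N, 2)%:R * (b * mu).
Proof.
have bd p : bm (fun w => capped b (J p w) - mu).
  by apply: (@bm_comp _ _ _ (fun x => capped b x - mu) (J p)) => //; exact: bm_capped_dev.
have bY : bm (fun w => capped b (Y w)) by exact: (bm_capped_comp mY b0).
have dY0 : E0 ((fun x => capped b x - mu) \o Y) = 0.
  rewrite /comp meanB//; last exact: bm_cst.
  by rewrite mean_cst subrr.
have -> : E (fun w => (capped_sum w - 'C(N, 2)%:R * mu) ^+ 2) =
  E (fun w => \sum_(p in D) \sum_(q in D) (capped b (J p w) - mu) * (capped b (J q w) - mu)).
  apply: eq_mean => w; rewrite capped_sum_dev expr2 mulr_suml.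
  by apply: eq_bigr => p _; rewrite mulr_sumr.
rewrite mean_sum; last by move=> p _; apply: bm_sum => q _; exact: bmM.
rewrite -card_upper_pairs mulr_natl -sumr_const; apply: ler_sum => p pD.
rewrite mean_sum; last by move=> q _; exact: bmM.
rewrite (bigD1 p)//= big1 ?addr0; last first.
  move=> q /andP[qD qp].
  rewrite (@mean_J_pair (fun x => capped b x - mu) (fun x => capped b x - mu))//.
  - by rewrite dY0 mul0r.
  - exact: bm_capped_dev.
  - exact: bm_capped_dev.
  - by rewrite eq_sym.
have bsq : bm (fun x => (capped b x - mu) * (capped b x - mu)).
  by apply: bmM; exact: bm_capped_dev.
rewrite (@mean_J (fun x => (capped b x - mu) * (capped b x - mu)) p bsq pD).
have bbY : bm (fun w => b * capped b (Y w)) by apply: bmM => //; exact: bm_cst.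
have bmY : bm (fun w => mu * (2 * capped b (Y w) - mu)).
  apply: bmM; first exact: bm_cst.
  apply: bmB; last exact: bm_cst.
  by apply: bmM => //; exact: bm_cst.
apply: (@le_trans _ _ (E0 (fun w => b * capped b (Y w) - mu * (2 * capped b (Y w) - mu)))).
  apply: le_mean; [exact: (bm_comp bsq mY)|exact: bmB|].
  move=> w /=; have := capped_ge0 (Y w) b0; have := capped_le b (Y w).
  set u := capped b (Y w); set m := mean _ _ => h1 h2.
  have : u * u <= b * u by rewrite ler_wpM2r.
  lra.
have b2Y : bm (fun w => 2 * capped b (Y w)) by apply: bmM => //; exact: bm_cst.
rewrite meanB// meanZ// meanZ; last by apply: bmB => //; exact: bm_cst.
rewrite meanB//; last exact: bm_cst.
rewrite meanZ// mean_cst -[E0 (fun w => capped b (Y w))]/mu.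
have := sqr_ge0 mu; set m := mean _ _; lra.
Qed.

(** The loss of the greedy choice of spins, through [norm_sum_ge] applied in
    each column j. *)
Definition collisions w : R :=
  \sum_(j < N) \sum_(i < N | (i < j)%N) \sum_(k < N | (k < j)%N && (k != i))
    Num.min (capped b (J (i, j) w)) (capped b (J (k, j) w)).

Lemma bm_min_capped p q : bm (fun w => Num.min (capped b (J p w)) (capped b (J q w))).
Proof.
split; last first.
  exists b => w; rewrite ger0_norm; first by rewrite ge_min capped_le.
  by rewrite le_min !capped_ge0.
exact: (measurable_minr (bm_cappedJ p).1 (bm_cappedJ q).1).
Qed.

Lemma bm_collisions : bm collisions.
Proof.
apply: bm_sum => j _; apply: bm_sum => i _; apply: bm_sum => k _.
exact: bm_min_capped.
Qed.

Lemma collisions_ge0 w : 0 <= collisions w.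
Proof.
apply: sumr_ge0 => j _; apply: sumr_ge0 => i _; apply: sumr_ge0 => k _.
by rewrite le_min !capped_ge0.
Qed.

Lemma bm_exceedR y : bm (fun x : R => (y < `|x|)%R%:R : R).
Proof. exact: (@bm_exceed R _ R id (@measurable_id _ _ _) y). Qed.

Lemma mean_min_capped m p q : b <= 2 ^+ m -> p \in D -> q \in D -> p != q ->
  E (fun w => Num.min (capped b (J p w)) (capped b (J q w))) <=
  \sum_(k < m) 2 ^+ k.+1 * (tail P0 Y (2 ^+ k)) ^+ 2.
Proof.
move=> bm2 pD qD pq.
have be y r : bm (fun w => (y < `|J r w|)%R%:R : R) by exact: bm_exceed.
have H : forall k, bm (fun w => (2 ^+ k < `|J p w|)%R%:R * (2 ^+ k < `|J q w|)%R%:R : R).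
  by move=> k; exact: bmM.
apply: (@le_trans _ _ (E (fun w => \sum_(k < m) 2 ^+ k.+1 *
    ((2 ^+ k < `|J p w|)%R%:R * (2 ^+ k < `|J q w|)%R%:R)))).
  apply: le_mean; first exact: bm_min_capped.
    by apply: bm_sum => k _; apply: bmM => //; exact: bm_cst.
  by move=> w; exact: min_capped_le_dyadic.
rewrite mean_sum; last by move=> k _; apply: bmM => //; exact: bm_cst.
apply: ler_sum => k _; rewrite meanZ// ler_wpM2l ?exprn_ge0//.
rewrite (@mean_J_pair (fun x => (2 ^+ k < `|x|)%R%:R) (fun x => (2 ^+ k < `|x|)%R%:R))//;
  try exact: bm_exceedR.
by rewrite expr2 -(mean_exceed P0 mY).
Qed.

Lemma mean_collisions m : b <= 2 ^+ m ->
  E collisions <= N%:R ^+ 3 * \sum_(k < m) 2 ^+ k.+1 * (tail P0 Y (2 ^+ k)) ^+ 2.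
Proof.
move=> bm2; set Q := \sum_(k < m) _.
have Q0 : 0 <= Q.
  by apply: sumr_ge0 => k _; apply: mulr_ge0; [exact: exprn_ge0|exact: sqr_ge0].
have count_le (p : pred 'I_N) (c : R) : 0 <= c -> \sum_(i < N | p i) c <= N%:R * c.
  move=> c0; rewrite sumr_const -[leLHS]mulr_natl ler_wpM2r// ler_nat.
  by rewrite (leq_trans (max_card _))// card_ord.
rewrite mean_sum; last first.
  by move=> j _; apply: bm_sum => i _; apply: bm_sum => k _; exact: bm_min_capped.
rewrite !exprS expr0 mulr1 -!mulrA.
apply: le_trans (count_le predT _ _); last by rewrite !mulr_ge0.
apply: ler_sum => j _; rewrite mean_sum; last first.
  by move=> i _; apply: bm_sum => k _; exact: bm_min_capped.
apply: le_trans (count_le (fun i : 'I_N => (i < j)%N) _ _); last by rewrite !mulr_ge0.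
apply: ler_sum => i ij; rewrite mean_sum; last by move=> k _; exact: bm_min_capped.
apply: le_trans (count_le (fun k : 'I_N => (k < j)%N && (k != i)) _ Q0).
apply: ler_sum => k /andP[kj ki]; apply: mean_min_capped => //; rewrite ?inE//=.
by apply: contraNneq ki => -[->].
Qed.

Definition exceedances y w : R := \sum_(p in D) (y < `|J p w|)%R%:R.

Lemma bm_exceedances y : bm (exceedances y).
Proof. by apply: bm_sum => p _; exact: bm_exceed. Qed.

Lemma mean_exceedances y : E (exceedances y) = 'C(N, 2)%:R * tail P0 Y y.
Proof.
rewrite mean_sum; last by move=> p _; exact: bm_exceed.
rewrite -card_upper_pairs mulr_natl -sumr_const; apply: eq_bigr => p pD.
rewrite (@mean_J (fun x => (y < `|x|)%R%:R))//; last exact: bm_exceedR.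
by rewrite -(mean_exceed P0 mY).
Qed.

Lemma exceedances_ge0 y w : 0 <= exceedances y w.
Proof. by apply: sumr_ge0. Qed.

Lemma energy_large_ge w : exists s,
  capped_sum w - collisions w <= energy (fun p => large (J p w)) s.
Proof.
have [s Hs] := greedy_spins (fun p => large (J p w)); exists s; rewrite Hs.
have -> : capped_sum w = \sum_(j < N) \sum_(i < N | (i < j)%N) capped b (J (i, j) w).
  rewrite (exchange_big_dep predT)//= pair_big_dep/=.
  by apply: eq_big => [[i j]|[i j] _] //=; rewrite inE.
rewrite /collisions -sumrB; apply: ler_sum => j _.
have := @norm_sum_ge R _ (fun i : 'I_N => (i < j)%N)
  (fun i => large (J (i, j) w) * spin (s i)) b b0; rewrite /=.
have e i : Num.min `|large (J (i, j) w) * spin (s i)| b = capped b (J (i, j) w).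
  by rewrite normrM normr_spin mulr1.
apply: le_trans; rewrite le_eqVlt; apply/orP; left; apply/eqP; congr (_ - _).
  by apply: eq_bigr => i _; rewrite e.
by apply: eq_bigr => i _; apply: eq_bigr => k _; rewrite !e.
Qed.

(** As exceedances count couplings, having less than one above M means that
    there is none; those between b and M cost at most M each. *)
Lemma energy_large_le M w : b <= M -> exceedances M w < 1 -> forall s,
  energy (fun p => large (J p w)) s <= capped_sum w + M * exceedances b w.
Proof.
move=> bM HM s; apply: (le_trans (energy_le _ _)).
rewrite /capped_sum /exceedances mulr_sumr -big_split/=; apply: ler_sum => p pD.
have xM : `|J p w| <= M.
  rewrite leNgt; apply/negP => xM; move: HM; rewrite /exceedances (bigD1 p)//= xM.
  by rewrite ltNge lerDl sumr_ge0.
have M0 : 0 <= M by exact: le_trans bM.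
have [x1|x1] := leP `|J p w| 1.
  by rewrite /large ltNge x1/= mulr0 normr0 addr_ge0 ?capped_ge0// mulr_ge0.
rewrite capped_large// /large x1 mulr1.
have [xb|bx] := leP `|J p w| b.
  by rewrite lerDl mulr0.
by rewrite mulr1 ler_wpDl.
Qed.

End Capped.

Lemma ln_partition_function_approx b M A beta w : 1 < b -> b <= M -> 0 <= beta ->
  small_partition w <= expR A -> exceedances M w < 1 ->
  beta * (capped_sum b w - collisions b w - A) <=
    ln (partition_function beta (fun p => J p w)) /\
  ln (partition_function beta (fun p => J p w)) <=
    N%:R * ln 2 + beta * (capped_sum b w + M * exceedances b w + A).
Proof.
move=> b1 bM beta0 HA HM; have Hs := small_energy_le HA.
have e s : energy (fun p => J p w) s =
    small_energy s w + energy (fun p => large (J p w)) s.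
  by rewrite /small_energy -energyD; congr energy; apply/funext => p; exact: small_large.
split.
  have [s H] := energy_large_ge b1 w.
  apply: le_trans (ln_partition_function_ge _ _ s); rewrite ler_wpM2l// e.
  by have := Hs s; rewrite ler_norml => /andP[? _]; lra.
apply: ln_partition_function_le => // s; rewrite e.
have := energy_large_le b1 bM HM s.
by have := Hs s; rewrite ler_norml => /andP[_ ?]; lra.
Qed.

End FixedSize.

(** * Concentration of the log-partition function *)

Section Concentration.
Context {R : realType} d0 (T0 : measurableType d0) (P0 : probability T0 R).
Variable Y : T0 -> R.
Hypothesis mY : measurable_fun setT Y.
Hypothesis small_centered : mean P0 (small \o Y) = 0.
Context (N : nat) d (T : measurableType d) (P : probability T R).
Variable J : 'I_N * 'I_N -> T -> R.
Hypothesis mJ : forall p, measurable_fun setT (J p).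
Hypothesis iidJ : iid_copies P0 Y P (upper_pairs N) J.

Definition log_partition beta w := ln (partition_function beta (fun p => J p w)).

Lemma measurable_log_partition beta : measurable_fun setT (log_partition beta).
Proof.
apply: (measurableT_comp (@measurable_ln R)); apply: measurable_sum => s.
apply: (measurableT_comp (@measurable_expR R)).
apply: measurable_funM; first exact: measurable_cst.
apply: measurable_sum => i.
under eq_fun do rewrite big_mkcond/=.
apply: measurable_sum => j; case: (i < j)%N; last exact: measurable_cst.
apply: measurable_funM; last exact: measurable_cst.
by apply: measurable_funM; last exact: measurable_cst.
Qed.

Lemma measurable_log_partition_between beta x y :
  measurable [set w | x <= log_partition beta w <= y].
Proof.
have mL := measurable_log_partition beta.
rewrite (_ : [set w | _] = [set w | x <= log_partition beta w] `&`
    [set w | log_partition beta w <= y]).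
  apply: measurableI; rewrite -[X in measurable X]setTI;
    apply: measurable_fun_ler => //; exact: measurable_cst.
by apply/seteqP; split => w /=; [move=> /andP|move=> ?; apply/andP].
Qed.

Variables (b M A y2 y3 y5 beta : R) (m : nat).
Hypotheses (b1 : 1 < b) (bM : b <= M) (bm : b <= 2 ^+ m).
Hypotheses (y2p : 0 < y2) (y3p : 0 < y3) (y5p : 0 < y5) (beta0 : 0 <= beta).
Local Notation mu := (mean P0 (capped b \o Y)).
Local Notation s2 := (mean P0 (fun w => small (Y w) ^+ 2)).
Local Notation n2 := ('C(N, 2)%:R).

(** Outside five events, estimated by Markov's inequality, the deterministic
    bounds of [ln_partition_function_approx] apply: an atypical small part, a
    deviation of the capped sum, too many collisions, a coupling above M, too
    many couplings above b. *)
Lemma log_partition_concentration :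
  (P (~` [set w | (beta * (n2 * mu - y2 - y3 - A) <= log_partition beta w <=
        N%:R * ln 2 + beta * (n2 * mu + y2 + M * y5 + A))%R]) <=
   (2 ^+ N * (2 * expR (2 * s2 * n2)) / expR A + n2 * (b * mu) / y2 ^+ 2 +
    N%:R ^+ 3 * (\sum_(k < m) 2 ^+ k.+1 * (tail P0 Y (2 ^+ k)) ^+ 2) / y3 +
    n2 * tail P0 Y M / 2^-1 + n2 * tail P0 Y b / y5)%:E)%E.
Proof.
have b0 : 0 <= b := ltW (lt_trans ltr01 b1).
pose B1 := [set w | expR A < small_partition J w].
pose B2 := [set w | y2 ^+ 2 < (capped_sum J b w - n2 * mu) ^+ 2].
pose B3 := [set w | y3 < collisions J b w].
pose B4 := [set w | 2^-1 < exceedances J M w].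
pose B5 := [set w | y5 < exceedances J b w].
have mgt (f : T -> R) c : bounded_measurable f -> measurable [set w | c < f w].
  move=> [mf _]; rewrite -[X in measurable X]setTI.
  by apply: measurable_fun_ltr => //; exact: measurable_cst.
have mB1 : measurable B1 by apply: mgt; exact: bm_small_partition.
have mB2 : measurable B2 by apply: mgt; exact: bm_sqr_dev.
have mB3 : measurable B3 by apply: mgt; exact: bm_collisions.
have mB4 : measurable B4 by apply: mgt; exact: bm_exceedances.
have mB5 : measurable B5 by apply: mgt; exact: bm_exceedances.
have H1 : (P B1 <= (2 ^+ N * (2 * expR (2 * s2 * n2)) / expR A)%:E)%E.
  apply: (le_trans (markov_mean P (bm_small_partition mJ)
    (small_partition_ge0 J) (expR_gt0 A))).
  rewrite lee_fin ler_wpM2r ?invr_ge0 ?expR_ge0//.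
  exact: (mean_small_partition mY small_centered mJ iidJ).
have H2 : (P B2 <= (n2 * (b * mu) / y2 ^+ 2)%:E)%E.
  apply: (le_trans (markov_mean P (bm_sqr_dev P0 Y mJ b1) _ _)).
  - by move=> w; exact: sqr_ge0.
  - by rewrite exprn_gt0.
  - rewrite lee_fin ler_wpM2r ?invr_ge0 ?exprn_ge0 ?(ltW y2p)//.
    exact: (mean_sqr_dev mY mJ iidJ b1).
have H3 : (P B3 <= (N%:R ^+ 3 * (\sum_(k < m) 2 ^+ k.+1 * (tail P0 Y (2 ^+ k)) ^+ 2)
    / y3)%:E)%E.
  apply: (le_trans (markov_mean P (bm_collisions mJ b1) (collisions_ge0 J b1) y3p)).
  rewrite lee_fin ler_wpM2r ?invr_ge0 ?(ltW y3p)//.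
  exact: (mean_collisions mY mJ iidJ b1 bm).
have H4 : (P B4 <= (n2 * tail P0 Y M / 2^-1)%:E)%E.
  apply: (le_trans (markov_mean P (bm_exceedances mJ M) (exceedances_ge0 J M) _)).
    by rewrite invr_gt0.
  by rewrite (mean_exceedances mY mJ iidJ).
have H5 : (P B5 <= (n2 * tail P0 Y b / y5)%:E)%E.
  apply: (le_trans (markov_mean P (bm_exceedances mJ b) (exceedances_ge0 J b) y5p)).
  by rewrite (mean_exceedances mY mJ iidJ).
set G := [set w | _].
have sub : ~` G `<=` B1 `|` B2 `|` B3 `|` B4 `|` B5.
  move=> w Gw; apply: contrapT => nB; apply: Gw.
  have n1 : small_partition J w <= expR A.
    by rewrite leNgt; apply/negP => h; apply: nB; do 4 left.
  have n2' : (capped_sum J b w - n2 * mu) ^+ 2 <= y2 ^+ 2.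
    by rewrite leNgt; apply/negP => h; apply: nB; do 3 left; right.
  have n3 : collisions J b w <= y3.
    by rewrite leNgt; apply/negP => h; apply: nB; do 2 left; right.
  have n4 : exceedances J M w <= 2^-1.
    by rewrite leNgt; apply/negP => h; apply: nB; left; right.
  have n5 : exceedances J b w <= y5.
    by rewrite leNgt; apply/negP => h; apply: nB; right.
  have n4' : exceedances J M w < 1 by lra.
  have [h1 h2] := ln_partition_function_approx b1 bM beta0 n1 n4'.
  have : `|capped_sum J b w - n2 * mu| <= y2.
    by rewrite -ler_sqr ?nnegrE ?normr_ge0 ?(ltW y2p)// real_normK ?num_real.
  rewrite ler_norml => /andP[h3 h4].
  rewrite /G /= /log_partition; apply/andP; split.
    by apply: le_trans h1; rewrite ler_wpM2l//; lra.
  have h5 : M * exceedances J b w <= M * y5 by rewrite ler_wpM2l// (le_trans b0).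
  by apply: (le_trans h2); rewrite lerD2l ler_wpM2l//; lra.
have mG : measurable G by exact: measurable_log_partition_between.
have mU : measurable (B1 `|` B2 `|` B3 `|` B4 `|` B5) by do 4 apply: measurableU => //.
apply: (@le_trans _ _ (P (B1 `|` B2 `|` B3 `|` B4 `|` B5))).
  by apply: le_measure; rewrite ?inE//; exact: measurableC.
rewrite !EFinD.
have leU (C1 C2 : set T) x1 x2 : measurable C1 -> measurable C2 ->
    (P C1 <= x1 -> P C2 <= x2 -> P (C1 `|` C2) <= x1 + x2)%E.
  by move=> mC1 mC2 p1 p2; rewrite (le_trans (measureU2 _ _ _))// leeD.
do 4 (apply: (leU) => //; try by do ?apply: measurableU).
Qed.

End Concentration.

(** * Size of the error terms *)

Section ErrorTerms.
Context {R : realType}.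
Implicit Types x y eta delta h b mu s : R.

Lemma ln2_le1 : ln 2 <= 1 :> R.
Proof.
rewrite -[leRHS]expRK ler_ln ?posrE ?expR_gt0//.
by have := expR_ge1Dx (1 : R); lra.
Qed.

(** The exponent 40 N absorbs the entropy (2^N <= exp N) and the exponential
    moment (at most exp (37 N)) and leaves exp (-2 N). *)
Lemma small_term (N : nat) s delta : 0 < delta -> 0 <= s -> N%:R * s <= 37 ->
  10 / delta <= N%:R ->
  2 ^+ N * (2 * expR (2 * s * 'C(N, 2)%:R)) / expR (40 * N%:R) <= delta / 5.
Proof.
move=> delta0 s0 Ns N4; have N0 : 0 <= N%:R :> R by [].
have g1 : 2 ^+ N <= expR N%:R :> R.
  rewrite -[N%:R]mulr1 expRM_natl lerXn2r ?nnegrE ?expR_ge0//.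
  by have := expR_ge1Dx (1 : R); lra.
have g2 : expR (2 * s * 'C(N, 2)%:R) <= expR (37 * N%:R).
  rewrite ler_expR bin2R; have := ler_wpM2l N0 Ns.
  have : 0 <= N%:R * s by rewrite mulr_ge0.
  lra.
have g3 : 2 ^+ N * (2 * expR (2 * s * 'C(N, 2)%:R)) <=
    expR N%:R * (2 * expR (37 * N%:R)).
  by rewrite ler_pM// ?exprn_ge0 ?mulr_ge0 ?expR_ge0// ler_wpM2l.
apply: (@le_trans _ _ (expR N%:R * (2 * expR (37 * N%:R)) / expR (40 * N%:R))).
  by rewrite ler_wpM2r// invr_ge0 expR_ge0.
rewrite mulrCA -expRD -mulrA -expRN -expRD.
have -> : N%:R + 37 * N%:R + - (40 * N%:R) = - (2 * N%:R) :> R by ring.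
rewrite expRN ler_pdivrMr ?expR_gt0//.
have := expR_ge1Dx (2 * N%:R : R); set z := expR _ => hz.
move: N4; rewrite ler_pdivrMr// => N4.
have : delta / 5 * (1 + 2 * N%:R) <= delta / 5 * z by rewrite ler_wpM2l//; lra.
lra.
Qed.

Lemma variance_term (n2 b mu eta H delta : R) : 0 < eta -> 0 < H -> 0 < delta ->
  0 <= b -> n2 * mu <= H -> 5 / (eta ^+ 2 * delta) * b <= H ->
  n2 * (b * mu) / (eta * H) ^+ 2 <= delta / 5.
Proof.
move=> eta0 H0 delta0 b0 n2mu hb.
rewrite ler_pdivrMr ?exprn_gt0 ?mulr_gt0//.
have g1 : 5 * b <= H * (eta ^+ 2 * delta).
  by rewrite -ler_pdivrMr ?mulr_gt0 ?exprn_gt0// mulrAC.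
have g2 : b * (n2 * mu) <= b * H by rewrite ler_wpM2l.
have g3 : H * (5 * b) <= H * (H * (eta ^+ 2 * delta)) by rewrite ler_wpM2l// ltW.
have -> : n2 * (b * mu) = b * (n2 * mu) by ring.
apply: (le_trans g2).
have -> : delta / 5 * (eta * H) ^+ 2 = H * (H * (eta ^+ 2 * delta)) / 5 by field.
lra.
Qed.

Lemma collision_term (N S eta h delta : R) : 0 < N -> 0 < eta -> 0 < h -> 0 < delta ->
  N ^+ 2 * S <= 162 -> 162 * 5 / (eta * delta) <= h ->
  N ^+ 3 * S / (eta * (N * h)) <= delta / 5.
Proof.
move=> N0 eta0 h0 delta0 hS hh; rewrite ler_pdivrMr ?mulr_gt0//.
have g2 : 162 * 5 <= h * (eta * delta) by rewrite -ler_pdivrMr ?mulr_gt0.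
have -> : N ^+ 3 * S = N * (N ^+ 2 * S) by ring.
apply: (le_trans (ler_wpM2l (ltW N0) hS)).
have := ler_wpM2l (ltW N0) g2; lra.
Qed.

Lemma overflow_term (x p b eta H delta : R) : 0 < eta -> 0 < H -> 0 < delta ->
  0 < p -> 0 < b -> x <= 3 -> 5 * 3 * p / (eta * delta) * b <= H ->
  x / (eta * H / (p * b)) <= delta / 5.
Proof.
move=> eta0 H0 delta0 p0 b0 x3 hb; rewrite ler_pdivrMr ?divr_gt0 ?mulr_gt0//.
have -> : delta / 5 * (eta * H / (p * b)) = H * (eta * delta) / 5 / (p * b).
  by field; rewrite !gt_eqF.
apply: (le_trans x3); rewrite ler_pdivlMr ?mulr_gt0//.
have g2 : 5 * 3 * p * b <= H * (eta * delta).
  by rewrite -ler_pdivrMr ?mulr_gt0// mulrAC.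
lra.
Qed.

Lemma count_mean_bounds (N mu h : R) : 1 <= N -> `|h - N * mu| <= 77 -> 77 <= h ->
  N * h / 2 - h / 2 - 39 * N <= N * (N - 1) / 2 * mu <= N * h / 2 + 39 * N /\
  N * (N - 1) / 2 * mu <= N * h.
Proof.
move=> N1; rewrite ler_norml => /andP[h1 h2] h77.
have g1 : 0 <= (N * mu - h + 77) * (N - 1) by rewrite mulr_ge0//; lra.
have g2 : 0 <= (h + 77 - N * mu) * (N - 1) by rewrite mulr_ge0//; lra.
have g3 : 0 <= N * (h - 77) by rewrite mulr_ge0//; lra.
by split; [apply/andP; split|]; lra.
Qed.

(** The energy errors linear in N add up to 79 N, and each bound carries two
    errors eta N h; the choice eta = e / (5 beta) leaves room for the entropy,
    for h / 2 and for the linear errors. *)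
Lemma deviation_bound (N h beta e eta mu n2 Z : R) :
  1 <= N -> 77 <= h -> 0 < beta -> 0 < e -> eta = e / (5 * beta) ->
  eta^-1 <= N -> (1 + 79 * beta) / (beta * eta) <= h ->
  N * h / 2 - h / 2 - 39 * N <= n2 * mu <= N * h / 2 + 39 * N ->
  beta * (n2 * mu - eta * (N * h) - eta * (N * h) - 40 * N) <= Z ->
  Z <= N * ln 2 + beta * (n2 * mu + eta * (N * h) + eta * (N * h) + 40 * N) ->
  `|(N * h)^-1 * Z - beta / 2| <= e.
Proof.
move=> N1 h77 beta0 e0 etaE N3 h2 /andP[f4 f5] g1 g2.
have eta0 : 0 < eta by rewrite etaE divr_gt0// mulr_gt0.
have N0 : 0 <= N by lra.
have H0 : 0 < N * h by rewrite mulr_gt0; lra.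
have l2 : N * ln 2 <= N by rewrite ler_piMr ?ln2_le1.
have f1 : h <= eta * (N * h).
  have : 1 <= N * eta by rewrite -ler_pdivrMr// div1r.
  by rewrite mulrA [eta * N]mulrC => ?; rewrite ler_peMl//; lra.
have f2 : (1 + 79 * beta) * N <= beta * (eta * (N * h)).
  move: h2; rewrite ler_pdivrMr ?mulr_gt0// => h2.
  have := ler_wpM2r N0 h2; lra.
have -> : (N * h)^-1 * Z - beta / 2 = (Z - beta * (N * h) / 2) / (N * h).
  by move: H0; set H := N * h => H0; field; rewrite gt_eqF.
rewrite normrM [X in _ * X]gtr0_norm ?invr_gt0// ler_pdivrMr//.
have -> : e * (N * h) = 5 * (beta * (eta * (N * h))).
  by rewrite etaE; field; rewrite gt_eqF.
have k4 := ler_wpM2l (ltW beta0) f4.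
have k5 := ler_wpM2l (ltW beta0) f5.
have k1 := ler_wpM2l (ltW beta0) f1.
by rewrite ler_norml; apply/andP; split; lra.
Qed.

End ErrorTerms.

(** * Convergence of the free energy *)

Section FreeEnergy.
Context {R : realType} d0 (T0 : measurableType d0) (P0 : probability T0 R).
Variables (X : {RV P0 >-> R}) (L : R -> R).
Hypothesis X_symmetric : symmetric_rv P0 X.
Hypothesis L_gt0 : forall x : R, 0 < x -> 0 < L x.
Hypothesis L_slowly_varying : slowly_varying L.
Hypothesis X_tail : forall x : R, 0 < x -> P0 [set w | x < `|X w|] = (L x / x)%:E.

Local Notation t := (tail P0 X).
Local Notation a := (a_ P0 X).
Local Notation b := (b_ P0 X).
Local Notation h := (h_ P0 X).
Let mX : measurable_fun setT X := measurable_funP X.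

Lemma mean_small_scaled N : mean P0 (small \o scaled X N) = 0.
Proof.
pose f x := small ((a N)^-1 * x).
have bf : bounded_measurable f.
  apply: (@bm_comp _ _ _ small ( *%R (a N)^-1)); first exact: bm_small.
  exact: mulrl_measurable.
have mNX : measurable_fun setT (fun w => - X w) by exact: measurable_funN.
have := mean_same_law mX mNX X_symmetric bf.
have -> : mean P0 (f \o (fun w => - X w)) = - mean P0 (f \o X).
  rewrite -mulN1r -meanZ; last exact: (bm_comp bf mX).
  by apply: eq_mean => w; rewrite /= /f mulrN smallN mulN1r.
move=> e; change (mean P0 (f \o X) = 0); lra.
Qed.

Lemma near_pow_le (e : R) : 0 < e -> exists k : nat, 6 * (2 / 3) ^+ k <= e.
Proof.
move=> e0; have : `|2 / 3| < 1 :> R by rewrite ger0_norm; lra.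
move=> /cvg_expr/cvgr_le/(_ (e / 6))[|k _ Hk]; first lra.
by exists k; have := Hk k (leqnn k) => /=; lra.
Qed.

Context (d : nat -> measure_display) (T : forall N, measurableType (d N))
  (P : forall N, probability (T N) R) (J : forall N, 'I_N * 'I_N -> {RV (P N) >-> R}).
Hypothesis iidJ : forall N : nat, 0 < a N ->
  iid_copies P0 (fun w => (a N)^-1 * X w) (P N) (upper_pairs N) (fun p => @J N p).
Variable beta : R.
Hypothesis beta_gt0 : 0 < beta.

(** The multiple 2^k of b is fixed first, so that a coupling above 2^k b is
    unlikely; then the four other error terms tend to 0. *)
Lemma near_concentration (e delta : R) : 0 < e -> 0 < delta ->
  \forall N \near \oo, (P N [set w | (e < `|(N%:R * h N)^-1 *
     ln (partition_function beta (fun p => @J N p w)) - beta / 2|)%R] <= delta%:E)%E.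
Proof.
move=> e0 delta0; have beta0 := beta_gt0.
pose eta := e / (5 * beta).
have eta0 : 0 < eta by rewrite /eta divr_gt0// mulr_gt0.
have [k Hk] := @near_pow_le (delta / 5) ltac:(lra).
have p2 j : 0 < 2 ^+ j :> R by rewrite exprn_gt0.
near=> N.
have N1 : 1 <= N%:R :> R by near: N; exact: nbhs_infty_ger.
have N3 : eta^-1 <= N%:R :> R by near: N; exact: nbhs_infty_ger.
have N4 : 10 / delta <= N%:R :> R by near: N; exact: nbhs_infty_ger.
have a0 : 0 < a N by near: N; exact: (near_scale_gt0 L_gt0 L_slowly_varying X_tail).
have b1 : 2 <= b N by near: N; exact: (near_cutoff_ge L_gt0 L_slowly_varying X_tail).
have h1 : 77 <= h N by near: N; exact: (near_h_ge L_gt0 L_slowly_varying X_tail).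
have h2 : (1 + 79 * beta) / (beta * eta) <= h N by near: N; exact: (near_h_ge L_gt0 L_slowly_varying X_tail).
have h3 : 162 * 5 / (eta * delta) <= h N by near: N; exact: (near_h_ge L_gt0 L_slowly_varying X_tail).
have hb1 : 5 / (eta ^+ 2 * delta) * b N <= N%:R * h N by near: N; exact: (near_cutoff_le_Nh L_gt0 L_slowly_varying X_tail).
have hb2 : 5 * 3 * 2 ^+ k / (eta * delta) * b N <= N%:R * h N by near: N; exact: (near_cutoff_le_Nh L_gt0 L_slowly_varying X_tail).
have hm : `|h N - N%:R * capped_mean X N| <= 77 by near: N; exact: (near_h_mean L_gt0 L_slowly_varying X_tail).
have hs : N%:R * mean P0 (fun w => small (scaled X N w) ^+ 2) <= 37.
  by near: N; exact: (near_sqr_small L_gt0 L_slowly_varying X_tail).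
have hp : forall m, N%:R ^+ 2 * \sum_(k < m) 2 ^+ k.+1 * (t (2 ^+ k * a N)) ^+ 2 <= 162.
  by near: N; exact: (near_pair_sum L_gt0 L_slowly_varying X_tail).
have ho : forall k, 'C(N, 2)%:R * t (2 ^+ k * b N * a N) <= 3 * (2 / 3) ^+ k.
  by near: N; exact: (near_overflow L_gt0 L_slowly_varying X_tail).
have [m [bm _]] : exists m : nat, b N <= 2 ^+ m /\ (3 / 2) ^+ m <= 9 / 4 * N%:R :> R.
  near: N; exact: (cutoff_poly (@tail_nonincreasing _ _ _ P0 X) (tail_gt0 L_gt0 X_tail)
    (tail_ratio_cvg L_gt0 L_slowly_varying X_tail)).
have Hi := iidJ a0.
have mJ p : measurable_fun setT (@J N p) by exact: measurable_funP.
set H := N%:R * h N in hb1 hb2 *.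
have H0 : 0 < H by rewrite /H mulr_gt0//; lra.
pose M := 2 ^+ k * b N.
have bM : b N <= M by rewrite /M ler_peMl ?exprn_ege1//; lra.
have M0 : 0 < M by lra.
have bgt1 : 1 < b N by lra.
have y2p : 0 < eta * H by rewrite mulr_gt0.
have y5p : 0 < eta * H / M by rewrite divr_gt0.
have HC := log_partition_concentration (measurable_scaled X N) (mean_small_scaled N)
  mJ Hi (40 * N%:R) bgt1 bM bm y2p y2p y5p (ltW beta0).
have h0 : 0 < h N by exact: lt_le_trans h1.
have N0 : 0 < N%:R :> R by exact: lt_le_trans N1.
have [f4 n2mu] := count_mean_bounds N1 hm h1.
rewrite -bin2R in f4 n2mu.
apply: (le_trans _ (le_trans HC _)); last first.
  rewrite lee_fin.
  have -> : delta = delta / 5 + delta / 5 + delta / 5 + delta / 5 + delta / 5 by field.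
  apply: lerD; first apply: lerD; first apply: lerD; first apply: lerD.
  - apply: small_term => //; apply: mean_ge0 => w; exact: sqr_ge0.
  - by apply: variance_term => //; exact: le_trans b1.
  - apply: collision_term => //.
    under eq_bigr do rewrite tail_scaled//.
    exact: hp.
  - rewrite tail_scaled// invrK mulrC; apply: le_trans Hk.
    have -> : 6 * (2 / 3) ^+ k = 2 * (3 * (2 / 3) ^+ k) :> R by ring.
    exact: (ler_wpM2l (ler0n R 2) (ho k)).
  - apply: (overflow_term (p := 2 ^+ k) (b := b N) eta0 H0 delta0 (p2 k)) => //.
      exact: lt_trans bgt1.
    by rewrite tail_scaled//; have := ho 0%N; rewrite !expr0 mul1r mulr1.
have mL := measurable_log_partition mJ beta.
apply: le_measure; rewrite ?inE.
- rewrite -[X in measurable X]setTI; apply: measurable_fun_ltr => //.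
  apply: measurableT_comp => //; apply: measurable_funB; last exact: measurable_cst.
  by apply: measurable_funM; first exact: measurable_cst.
- by apply: measurableC; exact: measurable_log_partition_between.
move=> w /= Hw /andP[g1 g2]; move: Hw; apply/negP; rewrite -leNgt.
have MH : M * (eta * H / M) = eta * H by rewrite mulrC mulfVK ?gt_eqF.
rewrite MH in g2.
exact: (deviation_bound N1 h1 beta0 e0 erefl N3 h2 f4 g1 g2).
Unshelve. all: by end_near. Qed.

Theorem free_energy_cvg : cvg_in_probability P
  (fun N w => (N%:R * h N)^-1 * ln (partition_function beta (fun p => @J N p w)))
  (beta / 2).
Proof.
move=> e e0; apply/fine_cvgP; split.
  near=> N.
  have a0 : 0 < a N by near: N; exact: (near_scale_gt0 L_gt0 L_slowly_varying X_tail).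
  apply: fin_num_measure; rewrite -[X in measurable X]setTI.
  apply: measurable_fun_ltr => //; apply: measurableT_comp => //.
  apply: measurable_funB; last exact: measurable_cst.
  apply: measurable_funM; first exact: measurable_cst.
  exact: (measurable_log_partition (fun p => measurable_funP (@J N p))).
apply/cvgr0Pnorm_le => delta delta0; near=> N; rewrite /= ger0_norm ?fine_ge0//.
have H : (P N [set w | (e < `|(N%:R * h N)^-1 *
     ln (partition_function beta (fun p => @J N p w)) - beta / 2|)%R] <= delta%:E)%E.
  by near: N; exact: near_concentration.
by rewrite -lee_fin fineK// ge0_fin_numE// (le_lt_trans H)// ltry.
Unshelve. all: by end_near. Qed.

End FreeEnergy.

Theorem theorem2p10 (R : realType)
    (d0 : measure_display) (T0 : measurableType d0) (P0 : probability T0 R)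
    (X : {RV P0 >-> R}) (L : R -> R)
    (X_symmetric : symmetric_rv P0 X)
    (L_gt0 : forall x : R, 0 < x -> 0 < L x)
    (L_slowly_varying : slowly_varying L)
    (X_tail : forall x : R, 0 < x -> P0 [set w | x < `|X w|] = (L x / x)%:E) :
  h_ P0 X N @[N --> \oo] --> +oo /\
  (forall eps : R, 0 < eps -> h_ P0 X N / (N%:R `^ eps) @[N --> \oo] --> (0 : R)) /\
  (forall (d : nat -> measure_display) (T : forall N, measurableType (d N))
      (P : forall N, probability (T N) R)
      (J : forall N, 'I_N * 'I_N -> {RV (P N) >-> R}),
    (forall N : nat, 0 < a_ P0 X N ->
       iid_copies P0 (fun w => (a_ P0 X N)^-1 * X w)
         (P N) (upper_pairs N) (fun p => J N p)) ->
    forall beta : R, 0 < beta ->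
      cvg_in_probability P
        (fun N w => (N%:R * h_ P0 X N)^-1 *
                    ln (partition_function beta (fun p => J N p w)))
        (beta / 2)).
Proof.
split; first exact: (h_pinfty L_gt0 L_slowly_varying X_tail).
split; first by move=> eps; exact: (h_negligible L_gt0 L_slowly_varying X_tail).
move=> d T P J iidJ beta beta0.
exact: (free_energy_cvg X_symmetric L_gt0 L_slowly_varying X_tail iidJ beta0).
Qed.
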